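(* Let $M$ be a monoid and let $X,Y$ be bi-equivariant classifying spaces for $M$. Then $X$ and $Y$ are $M\times M^{op}$-homotopy equivalent by a cellular $M\times M^{op}$-homotopy equivalence.
   Context: For a monoid $N$ (discrete topology), an $N$-set $P$ (set with left $N$-action) is projective if every surjective $N$-equivariant map onto $P$ has an $N$-equivariant section; equivalently $P\cong\coprod_{a\in A}Ne_a$ with each $e_a\in N$ idempotent. $N$-sets are regarded as discrete $N$-spaces (an $N$-space being a space with continuous left $N$-action); $I=[0,1]$, $B^n$ and $S^{n-1}=\partial B^n$ carry trivial $N$-actions. A projective $N$-CW complex is an $N$-space $X=\varinjlim X_n$ (along inclusions) where $X_0=P_0$ is a projective $N$-set and, for $n\ge1$, $X_n$ is a pushout of $N$-spaces $X_n=X_{n-1}\cup_{P_n\times S^{n-1}}(P_n\times B^n)$ along an $N$-equivariant continuous map $P_n\times S^{n-1}\to X_{n-1}$, with $P_n$ a projective $N$-set. It is a CW complex with $n$-skeleton $X_n$; a map is cellular if it preserves $n$-skeleta for all $n$. An $N$-homotopy between $N$-equivariant continuous maps $f,g\colon X\to Y$ is an $N$-equivariant continuous map $H\colon X\times I\to Y$ with $H(x,0)=f(x)$, $H(x,1)=g(x)$; write $f\simeq_N g$. An $N$-homotopy equivalence is an $N$-equivariant continuous map $f\colon X\to Y$ for which there is an $N$-equivariant continuous $g\colon Y\to X$ with $gf\simeq_N1_X$ and $fg\simeq_N1_Y$. Take $N=M\times M^{op}$. $M$ is an $M\times M^{op}$-set via $(m_L,m_R)m=m_Lmm_R$. A bi-equivariant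 classifying space for $M$ is a projective $M\times M^{op}$-CW complex $X$ such that $\pi_0(X)\cong M$ as an $M\times M^{op}$-set and each connected component of $X$ is contractible. *)

(* Defs.v *)
From HB Require Import structures.
From mathcomp Require Import all_boot all_order all_algebra.
From mathcomp Require Import all_classical all_reals all_analysis.
Import Order.TTheory GRing.Theory Num.Theory.
Import numFieldNormedType.Exports.

Set Implicit Arguments.
Unset Strict Implicit.
Unset Printing Implicit Defensive.

Local Open Scope classical_set_scope.
Local Open Scope ring_scope.
Local Open Scope quotient_scope.

Definition opp_monoid (M : Type) : Type := M.

Section opp_monoid.
Variable M : monoidType.
HB.instance Definition _ := Choice.on (opp_monoid M).

Let mulop (x y : opp_monoid M) : opp_monoid M := ((y : M) * (x : M))%g.
Let oneop : opp_monoid M := (1 : M)%g.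
Let mulopA : associative mulop.
Proof. by move=> x y z; rewrite /mulop mulgA. Qed.
Let mul1op : left_id oneop mulop.
Proof. by move=> x; rewrite /mulop mulg1. Qed.
Let mulop1 : right_id oneop mulop.
Proof. by move=> x; rewrite /mulop mul1g. Qed.

HB.instance Definition _ := isMonoid.Build (opp_monoid M) mulopA mul1op mulop1.
End opp_monoid.

HB.mixin Record isLeftAct (N : monoidType) (X : Type) := {
  act : N -> X -> X;
  act1 : forall x, act 1%g x = x;
  actM : forall a b x, act (a * b)%g x = act a (act b x)
}.

#[short(type="nsetType")]
HB.structure Definition NSet (N : monoidType) :=
  { X of Choice X & isLeftAct N X }.

HB.mixin Record NSet_isContinuousAct (N : monoidType) (X : Type)
    of Topological X & isLeftAct N X := {
  act_continuous :
    continuous (fun p : discrete_topology N * X => act (p.1 : N) p.2)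
}.

#[short(type="nspaceType")]
HB.structure Definition NSpace (N : monoidType) :=
  { X of Topological X & NSet N X & NSet_isContinuousAct N X }.

(* As N is discrete, joint continuity amounts to continuity of every act a. *)
Lemma continuous_discrete_prodP (N : choiceType) (X Y : topologicalType)
    (f : N -> X -> Y) :
  continuous (fun p : discrete_topology N * X => f p.1 p.2) <->
  forall a, continuous (f a).
Proof.
split=> [cf a x U fU|cf [a x] U /= /(cf a x) fU].
  have [[A B] /= [Aa Bx] AB] := cf (a, x) U fU.
  by apply: filterS Bx => y By; apply: (AB (a, y)); split => //; exact: Aa.
exists ([set a], [set y | U (f a y)]) => /=.
  by split => // b /= ->.
by case=> b y [/= -> ].
Qed.

Section product.
Variable N : monoidType.

Let act_pair (X Y : nsetType N) (a : N) (p : X * Y) := (act a p.1, act a p.2).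
Let act_pair1 (X Y : nsetType N) (p : X * Y) : act_pair 1%g p = p.
Proof. by case: p => x y; rewrite /act_pair !act1. Qed.
Let act_pairM (X Y : nsetType N) (a b : N) (p : X * Y) :
  act_pair (a * b)%g p = act_pair a (act_pair b p).
Proof. by rewrite /act_pair !actM. Qed.
HB.instance Definition _ (X Y : nsetType N) :=
  isLeftAct.Build N (X * Y)%type (@act_pair1 X Y) (@act_pairM X Y).

Let act_pair_continuous (X Y : nspaceType N) :
  continuous (fun p : discrete_topology N * (X * Y)%type =>
    act (p.1 : N) p.2).
Proof.
apply/(@continuous_discrete_prodP N _ _ (@act N (X * Y)%type)) => a p.
have /continuous_discrete_prodP cX := @act_continuous N X.
have /continuous_discrete_prodP cY := @act_continuous N Y.
apply: cvg_pair => /=.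
  by apply: continuous_comp; [exact: cvg_fst|exact: cX].
by apply: continuous_comp; [exact: cvg_snd|exact: cY].
Qed.
HB.instance Definition _ (X Y : nspaceType N) :=
  NSet_isContinuousAct.Build N (X * Y)%type (@act_pair_continuous X Y).
End product.

Definition discrete_nspace (N : monoidType) (P : Type) : Type :=
  discrete_topology P.

Section discrete_nspace.
Variables (N : monoidType) (P : nsetType N).
Local Notation T := (discrete_nspace N P).
HB.instance Definition _ := Topological.copy T (discrete_topology P).
HB.instance Definition _ := isLeftAct.Build N T (@act1 N P) (@actM N P).
Let discr_act_continuous :
  continuous (fun p : discrete_topology N * T => act (p.1 : N) p.2).
Proof.
apply/(@continuous_discrete_prodP N _ _ (@act N T)) => a.
by apply/continuousP => U _; exact: (@discrete_open (discrete_topology P)).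
Qed.
HB.instance Definition _ := NSet_isContinuousAct.Build N T discr_act_continuous.
End discrete_nspace.

Definition trivial_nspace (N : monoidType) (T : Type) : Type := T.

Section trivial_nspace.
Variables (N : monoidType) (T : topologicalType).
Local Notation X := (trivial_nspace N T).
HB.instance Definition _ := Topological.copy X T.
Let triv_act (_ : N) (x : X) := x.
HB.instance Definition _ := isLeftAct.Build N X
  (fun x => erefl : triv_act 1%g x = x)
  (fun a b x => erefl : triv_act (a * b)%g x = triv_act a (triv_act b x)).
Let triv_act_continuous :
  continuous (fun p : discrete_topology N * X => act (p.1 : N) p.2).
Proof.
by apply/(@continuous_discrete_prodP N _ _ (@act N X)) => a x U.
Qed.
HB.instance Definition _ := NSet_isContinuousAct.Build N X triv_act_continuous.
End trivial_nspace.

Section maps.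
Variable N : monoidType.

Definition equivariant (X Y : nsetType N) (f : X -> Y) :=
  forall a x, f (act a x) = act a (f x).

Definition nset_isomorphic (X Y : nsetType N) :=
  exists f : X -> Y, equivariant f /\ bijective f.

Definition projective (P : nsetType N) :=
  forall (Q : nsetType N) (f : Q -> P), equivariant f ->
    (forall p, exists q, f q = p) ->
    exists s : P -> Q, equivariant s /\ cancel s f.

Definition nmap (X Y : nspaceType N) (f : X -> Y) :=
  continuous f /\ equivariant f.

Definition nspace_iso (X Y : nspaceType N) (f : X -> Y) :=
  nmap f /\ exists g : Y -> X, [/\ nmap g, cancel f g & cancel g f].

(* The square    A -f-> B
                 |      |
                 g      i
                 v      v
                 C -j-> D   is a pushout of N-spaces. *)
Definition nspace_pushout (A B C D : nspaceType N)
    (f : A -> B) (g : A -> C) (i : B -> D) (j : C -> D) :=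
  [/\ nmap f, nmap g, nmap i, nmap j & i \o f = j \o g] /\
  forall (Z : nspaceType N) (h : B -> Z) (k : C -> Z),
    nmap h -> nmap k -> h \o f = k \o g ->
    exists! u : D -> Z, [/\ nmap u, u \o i = h & u \o j = k].

(* X is the colimit, with coprojections e, of the N-spaces S 0 -> S 1 -> ... *)
Definition nspace_colimit (S : nat -> nspaceType N)
    (t : forall n, S n -> S n.+1) (X : nspaceType N) (e : forall n, S n -> X) :=
  [/\ forall n, nmap (t n), forall n, nmap (e n)
    & forall n, e n.+1 \o t n = e n] /\
  forall (Z : nspaceType N) (h : forall n, S n -> Z),
    (forall n, nmap (h n)) -> (forall n, h n.+1 \o t n = h n) ->
    exists! u : X -> Z, nmap u /\ forall n, u \o e n = h n.

End maps.

Section balls.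
Variable R : realType.

Definition unit_interval : Type := (`[0 : R, 1]%classic : set R).
HB.instance Definition _ := Topological.on unit_interval.

Let mem_I0 : (0 : R) \in `[0 : R, 1]%classic.
Proof. by rewrite inE /= in_itv /= lexx ler01. Qed.
Let mem_I1 : (1 : R) \in `[0 : R, 1]%classic.
Proof. by rewrite inE /= in_itv /= lexx ler01. Qed.
Definition I0 : unit_interval := exist _ 0 mem_I0.
Definition I1 : unit_interval := exist _ 1 mem_I1.

(* The library norm on 'rV[R]_n is the sup norm, so the Euclidean ball and
   sphere are written with the sum of squares. *)
Definition ball_set n : set 'rV[R]_n := [set v | \sum_i v ord0 i ^+ 2 <= 1].
Definition sphere_set n : set 'rV[R]_n := [set v | \sum_i v ord0 i ^+ 2 = 1].

(* unit_sphere n is the boundary S^(n-1) of the n-ball unit_ball n. *)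
Definition unit_ball n : Type := @ball_set n.
Definition unit_sphere n : Type := @sphere_set n.
HB.instance Definition _ n := Topological.on (unit_ball n).
HB.instance Definition _ n := Topological.on (unit_sphere n).

Let sphere_sub_ball n (v : 'rV[R]_n) : v \in @sphere_set n -> v \in @ball_set n.
Proof. by rewrite !inE /sphere_set /ball_set /= => ->. Qed.
Definition sphere_ball n (v : unit_sphere n) : unit_ball n :=
  exist _ (val v) (sphere_sub_ball (valP v)).

End balls.

Definition cell_boundary (R : realType) (N : monoidType) (P : nsetType N) n
    (p : discrete_nspace N P * trivial_nspace N (unit_sphere R n)) :
    discrete_nspace N P * trivial_nspace N (unit_ball R n) :=
  (p.1, sphere_ball p.2).

Section homotopy.
Variables (R : realType) (N : monoidType).

Definition nhomotopic (X Y : nspaceType N) (f g : X -> Y) :=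
  exists H : X * trivial_nspace N (unit_interval R) -> Y,
    [/\ nmap H, forall x, H (x, I0 R) = f x & forall x, H (x, I1 R) = g x].

Definition nhomotopy_equivalence (X Y : nspaceType N) (f : X -> Y) :=
  nmap f /\ exists g : Y -> X,
    [/\ nmap g, nhomotopic (g \o f) id & nhomotopic (f \o g) id].

End homotopy.

Definition contractible (R : realType) (T : topologicalType) :=
  exists (x0 : T) (H : T * unit_interval R -> T),
    [/\ continuous H, forall x, H (x, I0 R) = x & forall x, H (x, I1 R) = x0].

Section path_components.
Variable R : realType.

Definition path_related (X : topologicalType) (x y : X) :=
  exists g : unit_interval R -> X, [/\ continuous g, g (I0 R) = x & g (I1 R) = y].

Section equivalence.
Variable X : topologicalType.

Lemma path_related_refl (x : X) : path_related x x.
Proof. by exists (fun=> x); split => //; exact: cst_continuous. Qed.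

(* The retraction of R onto [0, 1]: paths are concatenated as maps on R, where
   the closed-cover gluing lemma applies. *)
Let clamp_mem (t : R) : Num.max 0 (Num.min t 1) \in `[0 : R, 1]%classic.
Proof.
rewrite inE /= in_itv /= le_max lexx /= ge_max ler01 /=.
by rewrite ge_min lexx orbT.
Qed.
Let clamp (t : R) : unit_interval R :=
  exist (fun t : R => t \in `[0 : R, 1]%classic) _ (clamp_mem t).

Let clamp_continuous : continuous clamp.
Proof.
apply/continuousP => _ [W oW <-].
rewrite -comp_preimage.
apply: (open_comp _ oW) => t _ /=.
apply: (@continuous_max R R (fun=> 0) (fun t => Num.min t 1)) => //.
  exact: cvg_cst.
by apply: (@continuous_min R R id (fun=> 1)) => //; exact: cvg_cst.
Qed.

Let clampE (t : unit_interval R) : clamp (val t) = t.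
Proof.
apply: val_inj => /=.
have := valP t; rewrite inE /= in_itv /= => /andP[t0 t1].
by rewrite (min_idPl t1) (max_idPr t0).
Qed.

Let val_continuous : continuous (val : unit_interval R -> R).
Proof. exact: initial_continuous. Qed.

Let clamp0 (t : R) : t <= 0 -> clamp t = I0 R.
Proof.
move=> t0; apply: val_inj => /=; apply/max_idPl.
by rewrite ge_min t0.
Qed.

Let clamp1 (t : R) : 1 <= t -> clamp t = I1 R.
Proof.
move=> t1; apply: val_inj => /=; rewrite (min_idPr t1).
by apply/max_idPr; exact: ler01.
Qed.

Let continuous_compose (U V W : topologicalType) (f : U -> V) (g : V -> W) :
  continuous f -> continuous g -> continuous (fun x => g (f x)).
Proof. by move=> cf cg x; apply: continuous_comp; [exact: cf|exact: cg]. Qed.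

Lemma path_related_sym (x y : X) : path_related x y -> path_related y x.
Proof.
case=> g [cg g0 g1].
exists (fun t => g (clamp (1 - val t))); split.
- apply: continuous_compose cg.
  apply: continuous_compose clamp_continuous.
  move=> t; apply: (@continuousB R R (unit_interval R) (fun=> 1) val).
    exact: cst_continuous.
  exact: val_continuous.
- by rewrite clamp1 //= subr0.
- by rewrite clamp0 //= subrr.
Qed.

Lemma path_related_trans (y x z : X) :
  path_related x y -> path_related y z -> path_related x z.
Proof.
case=> g [cg g0 g1] [h [ch h0 h1]].
pose k (t : R) : X :=
  if t <= 2^-1 then g (clamp (2 * t)) else h (clamp (2 * t - 1)).
have c1 : continuous (fun t : R => g (clamp (2 * t))).
  apply: continuous_compose cg.
  apply: continuous_compose clamp_continuous.
  by move=> t; exact: mulrl_continuous.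
have c2 : continuous (fun t : R => h (clamp (2 * t - 1))).
  apply: continuous_compose ch.
  apply: continuous_compose clamp_continuous.
  move=> t; apply: (@continuousB R R R (fun t => 2 * t) (fun=> 1)).
    exact: mulrl_continuous.
  exact: cst_continuous.
have half2 : 2 * 2^-1 = 1 :> R by rewrite divff // pnatr_eq0.
have ck : continuous k.
  apply/continuous_subspace_setT.
  have -> : [set: R] = `]-oo, 2^-1] `|` `[2^-1, +oo[.
    apply/seteqP; split => // t _ /=; rewrite !in_itv /= andbT.
    by case: (leP t 2^-1) => [|/ltW]; [left|right].
  apply: withinU_continuous; [exact: interval_closed|exact: interval_closed| |].
    apply: (@subspace_eq_continuous _ _ _ (fun t : R => g (clamp (2 * t)))).
      by move=> t; rewrite inE /= in_itv /= /from_subspace /k => ->.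
    exact: continuous_subspaceT.
  apply: (@subspace_eq_continuous _ _ _ (fun t : R => h (clamp (2 * t - 1)))).
    move=> t; rewrite inE /= in_itv /= andbT /from_subspace /k => t2.
    case: ifPn => // t2'; have -> : t = 2^-1 by apply/le_anti/andP.
    rewrite half2 subrr (@clamp1 1) // (@clamp0 0) //.
    by rewrite g1 h0.
  exact: continuous_subspaceT.
exists (k \o val); split.
- by move=> t; apply: continuous_comp; [exact: val_continuous|exact: ck].
- rewrite /= /k invr_ge0 ler0n mulr0 clamp0 //.
- rewrite /= /k ifF; last by apply/negbTE; rewrite -ltNge invf_lt1 ?ltr1n ?ltr0n.
  rewrite clamp1 // mulr1 lerBrDr.
  by rewrite -(natrD R 1 1).
Qed.

Let path_rel (x y : X) := `[< path_related x y >].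
Let path_rel_refl : reflexive path_rel.
Proof. by move=> x; apply/asboolP/path_related_refl. Qed.
Let path_rel_sym : symmetric path_rel.
Proof.
by move=> x y; apply/asboolP/asboolP; exact: path_related_sym.
Qed.
Let path_rel_trans : transitive path_rel.
Proof.
by move=> y x z /asboolP xy /asboolP yz; apply/asboolP/(path_related_trans xy).
Qed.
Definition path_equiv := EquivRel path_rel path_rel_refl path_rel_sym path_rel_trans.

Definition pi0 : Type := {eq_quot path_equiv}.
HB.instance Definition _ := Choice.on pi0.
Definition pi0_class (x : X) : pi0 := \pi_{eq_quot path_equiv} x.

Lemma pi0_eqP (x y : X) : pi0_class x = pi0_class y <-> path_related x y.
Proof.
rewrite /pi0_class; split; first by move=> /eqmodP /asboolP.
by move=> xy; apply/eqmodP/asboolP.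
Qed.

Lemma pi0_classK (c : pi0) : pi0_class (repr (c : {eq_quot path_equiv})) = c.
Proof. exact: (@reprK _ {eq_quot path_equiv}). Qed.

End equivalence.

Section action.
Variables (N : monoidType) (X : nspaceType N).

Let act_pi0 (a : N) (c : pi0 X) : pi0 X :=
  pi0_class (act a (repr (c : {eq_quot path_equiv X}))).

Let act_pi0_class (a : N) (x : X) :
  act_pi0 a (pi0_class x) = pi0_class (act a x).
Proof.
apply/pi0_eqP.
have /pi0_eqP[g [cg g0 g1]] := pi0_classK (pi0_class x).
have /continuous_discrete_prodP cX := @act_continuous N X.
exists (act a \o g); split; rewrite /= ?g0 ?g1 //.
by move=> t; apply: continuous_comp; [exact: cg|exact: cX].
Qed.

Let act_pi01 (c : pi0 X) : act_pi0 1%g c = c.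
Proof. by rewrite -[c]pi0_classK act_pi0_class act1. Qed.
Let act_pi0M (a b : N) (c : pi0 X) : act_pi0 (a * b)%g c = act_pi0 a (act_pi0 b c).
Proof. by rewrite -[c]pi0_classK !act_pi0_class actM. Qed.
HB.instance Definition _ := isLeftAct.Build N (pi0 X) act_pi01 act_pi0M.

Lemma act_pi0E (a : N) (x : X) : act a (pi0_class x) = pi0_class (act a x).
Proof. exact: act_pi0_class. Qed.

End action.
End path_components.

(* The n-skeleta and the attaching and characteristic maps are data; X_n enters
   as an abstract N-space with its canonical map cw_incl n to X, and the pushout
   conditions force the cw_step n and cw_incl n to be embeddings. *)
Record projective_cw (R : realType) (N : monoidType) := ProjectiveCW {
  cw_space :> nspaceType N;
  cw_cells : nat -> nsetType N;
  cw_skel : nat -> nspaceType N;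
  cw_vertices : discrete_nspace N (cw_cells 0) -> cw_skel 0;
  cw_step : forall n, cw_skel n -> cw_skel n.+1;
  cw_attach : forall n,
    discrete_nspace N (cw_cells n.+1) *
      trivial_nspace N (unit_sphere R n.+1) -> cw_skel n;
  cw_char : forall n,
    discrete_nspace N (cw_cells n.+1) *
      trivial_nspace N (unit_ball R n.+1) -> cw_skel n.+1;
  cw_incl : forall n, cw_skel n -> cw_space;
  cw_projective : forall n, projective (cw_cells n);
  cw_vertices_iso : nspace_iso cw_vertices;
  cw_pushout : forall n,
    nspace_pushout (@cw_attach n) (@cell_boundary R N (cw_cells n.+1) n.+1)
      (@cw_step n) (@cw_char n);
  cw_colimit : nspace_colimit cw_step cw_incl
}.

Definition skeleton (R : realType) (N : monoidType) (X : projective_cw R N)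
  (n : nat) : set X := range (@cw_incl _ _ X n).
Arguments skeleton {R N} X n.

Definition cellular (R : realType) (N : monoidType) (X Y : projective_cw R N)
    (f : X -> Y) :=
  forall n, f @` skeleton X n `<=` skeleton Y n.

(* M with the M x M^op-action (mL, mR) m = mL m mR. *)
Definition biset (M : Type) : Type := M.

Section biset.
Variable M : monoidType.
HB.instance Definition _ := Choice.on (biset M).
Let biact (a : M * opp_monoid M) (m : biset M) : biset M :=
  ((a.1 : M) * (m : M) * (a.2 : M))%g.
Let biact1 m : biact 1%g m = m.
Proof. by rewrite /biact mul1g mulg1. Qed.
Let biactM a b m : biact (a * b)%g m = biact a (biact b m).
Proof. by rewrite /biact /= !mulgA. Qed.
HB.instance Definition _ :=
  isLeftAct.Build (M * opp_monoid M)%type (biset M) biact1 biactM.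
End biset.

Definition biequivariant_classifying_space (R : realType) (M : monoidType)
    (X : projective_cw R (M * opp_monoid M)%type) :=
  nset_isomorphic (pi0 R X) (biset M) /\
  forall x : X, contractible R (connected_component [set: X] x).

(* Main.v *)
Require Import Defs.
From HB Require Import structures.
From mathcomp Require Import all_boot all_order all_algebra.
From mathcomp Require Import zify ring lra.
From mathcomp Require Import all_classical all_reals all_analysis.
Import Order.TTheory GRing.Theory Num.Theory.
Import numFieldNormedType.Exports.

Set Implicit Arguments.
Unset Strict Implicit.
Unset Printing Implicit Defensive.

Local Open Scope classical_set_scope.
Local Open Scope ring_scope.

(** Let N be the acting monoid and let X, Y be the two complexes; besides
contractibility of the components the argument uses only an isomorphism
theta between the N-sets pi0 X and pi0 Y, so it works for any N.

Obstruction theory.  A projective N-set P is a retract of the free N-set on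
its points, so an arbitrary choice, for each q in P, of an extension over
the single ball {q} x B^n of a given map on P x S^(n-1) yields an equivariant
extension over P x B^n.  Hence maps out of X are built skeleton by skeleton by
solving ordinary, non-equivariant extension problems (cw_lifting).  This is
used twice.

Existence.  A map f : X -> Y inducing theta on pi0 is built with
f(X_n) inside Y_n.  A cell of dimension n+1 asks for an extension over B^(n+1)
of a map S^n -> Y_n.  Its image lies in one path component of Y, which is
contractible, so it extends to a map into Y (cone_extension), and the
extension has to be pushed into Y_(n+1) relative to S^n.  This is the
cellular approximation theorem (cellular_extension): by compactness the ball
lands in some Y_K, and as long as K > n+1 a map from B^(n+1) into Y_K can be
modified to miss the centre of each K-cell and then be retracted radially
into Y_(K-1) (compression).  To miss the centres, the map is approximated by
a Lipschitz map, and a Lipschitz image of a cube of R^m misses a point of a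
fine grid of R^k when m < k, by counting.

Uniqueness.  Two maps f, g : X -> Y inducing the same map on pi0 are
homotopic: a homotopy is a lift of (f, g) : X -> Y x Y along the evaluation
of paths at their endpoints, Y^I -> Y x Y, and the extension problem for a
cell takes place on the cylinder B^n x I, where cone_extension applies again
(cylinder_extension).  Mapping into the path space Y^I with the compact-open
topology avoids having to know that X x I is a colimit of the X_n x I.

Applied to theta and its inverse, existence gives f and g; applied to
composites and identities, uniqueness gives the homotopies.

The complexes are given by universal properties among N-spaces.  The cofree
N-spaces Z^N turn these into universal properties among spaces, and testing
them against the Sierpinski and the indiscrete spaces yields the point-set
facts about skeleta that are needed. *)

(** * Universal properties without the action *)

Lemma eq_compE (A B C D : Type) (f : B -> D) (g : A -> B) (h : C -> D) (k : A -> C) :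
  f \o g = h \o k -> forall x, f (g x) = h (k x).
Proof. by move=> E x; exact: (congr1 (@^~ x) E). Qed.

Lemma continuousT_comp (U V W : topologicalType) (f : U -> V) (g : V -> W) :
  continuous f -> continuous g -> continuous (g \o f).
Proof. by move=> cf cg x; apply: continuous_comp; [exact: cf|exact: cg]. Qed.

Lemma continuous_preimage (U V : topologicalType) (f : U -> V) (O : set V) :
  continuous f -> open O -> open (f @^-1` O).
Proof. by move=> /continuousP; apply. Qed.

Lemma continuous_pairfun (U V W : topologicalType) (f : U -> V) (g : U -> W) :
  continuous f -> continuous g -> continuous (fun x => (f x, g x)).
Proof. by move=> cf cg x; apply: cvg_pair => /=; [exact: cf|exact: cg]. Qed.

(** Maps into this space are the same thing as open subsets of the source,
which is how universal properties give information on open sets. *)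
Definition sierpinski : Type := bool.
HB.instance Definition _ := Choice.copy sierpinski bool.
Section sierpinski.
Let op (U : set sierpinski) := U false -> U true.
Let opT : op setT. Proof. by []. Qed.
Let opI : setI_closed op.
Proof. by move=> A B oA oB [/oA ? /oB ?]; split. Qed.
Let op_bigU (I : Type) (f : I -> set sierpinski) :
  (forall i, op (f i)) -> op (\bigcup_i f i).
Proof. by move=> of_ [i _ /of_ fi]; exists i. Qed.
HB.instance Definition _ := isOpenTopological.Build sierpinski opT opI op_bigU.

Lemma open_sierpinski_true : open ([set true] : set sierpinski).
Proof. by []. Qed.

Lemma sierpinski_continuous (T : topologicalType) (U : set T) :
  open U -> continuous (fun x => `[< U x >] : sierpinski).
Proof.
move=> oU; apply/continuousP => V oV.
have {}oV : V false -> V true by exact: oV.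
have [V0|V0] := pselect (V false).
  rewrite (_ : _ @^-1` _ = setT); first exact: openT.
  by apply/seteqP; split => // x _ /=; case: asboolP => // _; exact: oV.
have [V1|V1] := pselect (V true).
  rewrite (_ : _ @^-1` _ = U) //.
  by apply/seteqP; split => x /=; case: asboolP.
rewrite (_ : _ @^-1` _ = set0); first exact: open0.
by apply/seteqP; split => x //=; case: asboolP.
Qed.
End sierpinski.

(** As every map into an indiscrete space is continuous, universal properties
tested on these spaces describe the underlying sets. *)
Definition indiscrete (T : Type) : Type := T.
Section indiscrete.
Variable T : choiceType.
HB.instance Definition _ := Choice.copy (indiscrete T) T.
Let op (U : set (indiscrete T)) := forall x y, U x -> U y.
Let opT : op setT. Proof. by []. Qed.
Let opI : setI_closed op.
Proof. by move=> A B oA oB x y [/oA ? /oB ?]; split. Qed.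
Let op_bigU (I : Type) (f : I -> set (indiscrete T)) :
  (forall i, op (f i)) -> op (\bigcup_i f i).
Proof. by move=> of_ x y [i _ fix_]; exists i => //; apply: of_ fix_. Qed.
HB.instance Definition _ := isOpenTopological.Build (indiscrete T) opT opI op_bigU.

Lemma indiscrete_continuous (U : topologicalType) (f : U -> indiscrete T) :
  continuous f.
Proof.
apply/continuousP => V oV; have {}oV : forall x y, V x -> V y by exact: oV.
have [[x Vx]|V0] := pselect (exists x, V x).
  rewrite (_ : _ @^-1` _ = setT); first exact: openT.
  by apply/seteqP; split => // y _ /=; apply: oV Vx.
rewrite (_ : _ @^-1` _ = set0); first exact: open0.
by apply/seteqP; split => // y Vy; apply: V0; exists (f y).
Qed.
End indiscrete.

HB.instance Definition _ (N : monoidType) (P : nsetType N) :=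
  isLeftAct.Build N (indiscrete P) (@act1 N P) (@actM N P).
HB.instance Definition _ (N : monoidType) (P : nsetType N) :=
  NSet_isContinuousAct.Build N (indiscrete P) (@indiscrete_continuous P _ _).

Section act_facts.
Variable N : monoidType.

Lemma act_cont (X : nspaceType N) (a : N) : continuous (act a : X -> X).
Proof. by have /continuous_discrete_prodP := @act_continuous N X; apply. Qed.

Lemma nmap_comp (X Y Z : nspaceType N) (f : X -> Y) (g : Y -> Z) :
  nmap f -> nmap g -> nmap (g \o f).
Proof.
move=> [cf ef] [cg eg]; split; first exact: continuousT_comp.
by move=> a x /=; rewrite ef eg.
Qed.

Lemma nmap_id (X : nspaceType N) : nmap (@id X).
Proof. by split; [move=> x; exact: cvg_id | ]. Qed.
End act_facts.

(** The functor Z |-> Z^N is right adjoint to forgetting the action, so that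
pushouts and sequential colimits of N-spaces are also pushouts and colimits
of spaces.  The unit and the counit of the adjunction are cofree_lift id and
evaluation at 1. *)
Definition cofree (N : Type) (Z : Type) : Type := N -> Z.
Section cofree.
Variables (N : monoidType) (Z : topologicalType).
Local Notation T := (cofree N Z).
HB.instance Definition _ := Topological.copy T (prod_topology (fun _ : N => Z)).
Let cact (a : N) (f : T) : T := fun b => f (b * a)%g.
Let cact1 f : cact 1%g f = f.
Proof. by apply/funext => b; rewrite /cact mulg1. Qed.
Let cactM a b f : cact (a * b)%g f = cact a (cact b f).
Proof. by apply/funext => c; rewrite /cact mulgA. Qed.
HB.instance Definition _ := isLeftAct.Build N T cact1 cactM.

Lemma cofree_eval_continuous (a : N) : continuous (fun f : T => f a).
Proof. exact: (@proj_continuous _ (fun _ : N => Z) a). Qed.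

Lemma cofree_continuous (X : topologicalType) (f : X -> T) :
  (forall a, continuous (fun x => f x a)) -> continuous f.
Proof.
move=> cf x.
have F : Filter (f @ x) by apply: fmap_filter; exact: nbhs_filter.
pose TS (a : N) := Topological.class (initial_topology (fun g : N -> Z => g a)).
apply: (@cvg_sup _ _ TS (f @ x) (f x) F).2 => a.
exact: (@continuous_comp_initial _ _ _ (fun g : N -> Z => g a) f (cf a) x).
Qed.

Let cact_continuous :
  continuous (fun p : discrete_topology N * T => act (p.1 : N) p.2).
Proof.
apply/(@continuous_discrete_prodP N _ _ (@act N T)) => a.
by apply: cofree_continuous => b; exact: (@cofree_eval_continuous (b * a)%g).
Qed.
HB.instance Definition _ := NSet_isContinuousAct.Build N T cact_continuous.

Definition cofree_lift (X : nspaceType N) (h : X -> Z) : X -> T :=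
  fun x a => h (act a x).

Lemma cofree_lift_nmap (X : nspaceType N) (h : X -> Z) :
  continuous h -> nmap (cofree_lift h).
Proof.
move=> ch; split.
  apply: cofree_continuous => a; exact: (continuousT_comp (@act_cont N X a) ch).
by move=> a x; apply/funext => b; rewrite /cofree_lift -actM.
Qed.

Lemma cofree_lift_comp (X Y : nspaceType N) (f : X -> Y) (h : Y -> Z) :
  nmap f -> cofree_lift h \o f = cofree_lift (h \o f).
Proof.
by move=> [_ ef]; apply/funext => x; apply/funext => a; rewrite /cofree_lift /= ef.
Qed.

Definition cofree_eval1 (f : T) : Z := f 1%g.

Lemma cofree_eval1_continuous : continuous cofree_eval1.
Proof. exact: cofree_eval_continuous. Qed.

Lemma cofree_lift1 (X : nspaceType N) (h : X -> Z) :
  cofree_eval1 \o cofree_lift h = h.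
Proof. by apply/funext => x; rewrite /cofree_eval1 /cofree_lift /= act1. Qed.

End cofree.

Section pushout.
Variables (N : monoidType) (A B C D : nspaceType N).
Variables (f : A -> B) (g : A -> C) (i : B -> D) (j : C -> D).
Hypothesis po : nspace_pushout f g i j.

Lemma pushout_top (Z : topologicalType) (h : B -> Z) (k : C -> Z) :
  continuous h -> continuous k -> h \o f = k \o g ->
  exists u : D -> Z, [/\ continuous u, u \o i = h & u \o j = k].
Proof.
case: po => -[nf ng ni nj _] univ ch ck hk.
have [||//|u [[[cu _] ui uj] _]] := univ (cofree N Z) (cofree_lift h) (cofree_lift k).
- exact: cofree_lift_nmap.
- exact: cofree_lift_nmap.
- by rewrite (cofree_lift_comp _ nf) (cofree_lift_comp _ ng) hk.
exists (@cofree_eval1 N Z \o u); split.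
- exact: (continuousT_comp cu (@cofree_eval1_continuous _ _)).
- by rewrite -compA ui cofree_lift1.
- by rewrite -compA uj cofree_lift1.
Qed.

Lemma pushout_top_unique (Z : topologicalType) (u v : D -> Z) :
  continuous u -> continuous v -> u \o i = v \o i -> u \o j = v \o j -> u = v.
Proof.
case: po => -[nf ng ni nj sq] univ cu cv uvi uvj.
have [||//|w [_ wE]] := univ (cofree N Z) (cofree_lift (u \o i)) (cofree_lift (u \o j)).
- by apply: cofree_lift_nmap; exact: (continuousT_comp ni.1).
- by apply: cofree_lift_nmap; exact: (continuousT_comp nj.1).
- rewrite (cofree_lift_comp _ nf) (cofree_lift_comp _ ng).
  exact: (congr1 (fun h => cofree_lift (u \o h)) sq).
have wu : w = cofree_lift u.
  apply: wE; rewrite (cofree_lift_comp _ ni) (cofree_lift_comp _ nj).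
  by split=> //; exact: cofree_lift_nmap.
have wv : w = cofree_lift v.
  apply: wE; rewrite (cofree_lift_comp _ ni) (cofree_lift_comp _ nj) uvi uvj.
  by split=> //; exact: cofree_lift_nmap.
by rewrite -(cofree_lift1 u) -(cofree_lift1 v) -wu -wv.
Qed.

(** Otherwise the indicator function of the union of the two images and the
constant function true would be two different maps to the indiscrete space on
bool with the same restrictions. *)
Lemma pushout_surj (d : D) : (exists b, i b = d) \/ (exists c, j c = d).
Proof.
pose u (d : D) : indiscrete bool := true.
pose v (d : D) : indiscrete bool := `[< (exists b, i b = d) \/ (exists c, j c = d) >].
have uv : u = v.
  apply: pushout_top_unique; try exact: indiscrete_continuous.
    by apply/funext => b; rewrite /comp /u /v; apply/esym/asboolP; left; exists b.
  by apply/funext => c; rewrite /comp /u /v; apply/esym/asboolP; right; exists c.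
by have : v d = true by [rewrite -uv]; move/asboolP.
Qed.

(** The indicator functions of the two preimages are maps to the Sierpinski
space; they glue to the indicator function of U. *)
Lemma pushout_open (U : set D) : open (i @^-1` U) -> open (j @^-1` U) -> open U.
Proof.
move=> oi oj.
have [|u [cu ui uj]] := @pushout_top sierpinski _ _
  (sierpinski_continuous oi) (sierpinski_continuous oj).
  case: po => -[_ _ _ _ sq] _; apply/funext => a /=.
  by congr asbool; rewrite /preimage /=; have := congr1 (@^~ a) sq => /= ->.
rewrite (_ : U = u @^-1` [set true]).
  exact: (continuous_preimage cu open_sierpinski_true).
apply/seteqP; suff uE d : u d = `[< U d >] by split => d /=; rewrite uE => /asboolP.
have [[b <-]|[c <-]] := pushout_surj d.
  exact: (congr1 (@^~ b) ui).
exact: (congr1 (@^~ c) uj).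
Qed.

End pushout.

Section colimit.
Variables (N : monoidType) (S : nat -> nspaceType N) (t : forall n, S n -> S n.+1).
Variables (X : nspaceType N) (e : forall n, S n -> X).
Hypothesis colim : nspace_colimit t e.

Lemma colimit_top (Z : topologicalType) (h : forall n, S n -> Z) :
  (forall n, continuous (h n)) -> (forall n, h n.+1 \o @t n = h n) ->
  exists u : X -> Z, continuous u /\ forall n, u \o @e n = h n.
Proof.
case: colim => -[nt ne et] univ ch ht.
have [||u [[[cu _] ue] _]] := univ (cofree N Z) (fun n => cofree_lift (h n)).
- by move=> n; exact: cofree_lift_nmap.
- by move=> n; rewrite (cofree_lift_comp _ (nt n)) ht.
exists (@cofree_eval1 N Z \o u); split.
  exact: (continuousT_comp cu (@cofree_eval1_continuous _ _)).
by move=> n; rewrite -compA ue cofree_lift1.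
Qed.

Lemma colimit_top_unique (Z : topologicalType) (u v : X -> Z) :
  continuous u -> continuous v -> (forall n, u \o @e n = v \o @e n) -> u = v.
Proof.
case: colim => -[nt ne et] univ cu cv uv.
have [||w [_ wE]] := univ (cofree N Z) (fun n => cofree_lift (u \o @e n)).
- by move=> n; apply: cofree_lift_nmap; exact: (continuousT_comp (ne n).1).
- move=> n; rewrite (cofree_lift_comp _ (nt n)).
  exact: (congr1 (fun h => cofree_lift (u \o h)) (et n)).
have wu : w = cofree_lift u.
  apply: wE; split=> [|n]; first exact: cofree_lift_nmap.
  by rewrite (cofree_lift_comp _ (ne n)).
have wv : w = cofree_lift v.
  apply: wE; split=> [|n]; first exact: cofree_lift_nmap.
  by rewrite (cofree_lift_comp _ (ne n)) uv.
by rewrite -(cofree_lift1 u) -(cofree_lift1 v) -wu -wv.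
Qed.

Lemma colimit_surj (x : X) : exists n s, @e n s = x.
Proof.
pose u (x : X) : indiscrete bool := true.
pose v (x : X) : indiscrete bool := `[< exists n s, @e n s = x >].
have uv : u = v.
  apply: colimit_top_unique; try exact: indiscrete_continuous.
  by move=> n; apply/funext => s; rewrite /comp /u /v; apply/esym/asboolP; exists n, s.
by have : v x = true by [rewrite -uv]; move/asboolP.
Qed.

End colimit.

(** * Equivariant maps out of a projective complex *)

Definition free_nset (N P : Type) : Type := (N * P)%type.
Section free_nset.
Variables (N : monoidType) (P : nsetType N).
HB.instance Definition _ := Choice.copy (free_nset N P) (N * P)%type.
Let fact (a : N) (x : free_nset N P) : free_nset N P := ((a * x.1)%g, x.2).
Let fact1 x : fact 1%g x = x.
Proof. by case: x => a p; rewrite /fact mul1g. Qed.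
Let factM a b x : fact (a * b)%g x = fact a (fact b x).
Proof. by rewrite /fact mulgA. Qed.
HB.instance Definition _ := isLeftAct.Build N (free_nset N P) fact1 factM.

(** A section of the action map from the free N-set on P to P: the functions
a and q are its two components. *)
Lemma projective_retract : projective P ->
  exists (a : P -> N) (q : P -> P), [/\ forall p, act (a p) (q p) = p,
    forall n p, a (act n p) = (n * a p)%g & forall n p, q (act n p) = q p].
Proof.
move=> projP; have [||s [es sK]] := projP (free_nset N P) (fun x => act x.1 x.2).
- by move=> a x /=; rewrite actM.
- by move=> p; exists (1%g, p); rewrite /= act1.
exists (fun p => (s p).1), (fun p => (s p).2); split=> [p|n p|n p].
- exact: sK.
- by rewrite es.
- by rewrite es.
Qed.
End free_nset.

Lemma discrete_pair_continuous (P : choiceType) (T Z : topologicalType)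
    (k : P -> T -> Z) : (forall p, continuous (k p)) ->
  continuous (fun x : discrete_topology P * T => k x.1 x.2).
Proof. by move=> ck; apply/(@continuous_discrete_prodP P T Z k). Qed.

Section projective_cells.
Variables (N : monoidType) (P : nsetType N).
Hypothesis projP : projective P.

(** With the decomposition p = a p * q p of projective_retract, the extension
sends (p, t) to a p * psi (q p) t.  This is equivariant for arbitrary maps
psi q because a is equivariant and q is invariant. *)
Lemma projective_extension (S T : topologicalType) (iota : S -> T)
    (E B : nspaceType N) (e : E -> B)
    (g : discrete_nspace N P * trivial_nspace N S -> E)
    (b : discrete_nspace N P * trivial_nspace N T -> B)
    (psi : P -> T -> E) :
  nmap e -> nmap g -> nmap b ->
  (forall q, continuous (psi q)) ->
  (forall q s, psi q (iota s) = g (q, s)) ->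
  (forall q t, e (psi q t) = b (q, t)) ->
  exists k : discrete_nspace N P * trivial_nspace N T -> E,
    [/\ nmap k, forall p s, k (p, iota s) = g (p, s)
      & forall x, e (k x) = b x].
Proof.
move=> [ce ee] [cg eg] [cb eb] cpsi psig psib.
have [a [q [aq aM qM]]] := projective_retract projP.
exists (fun x => act (a x.1) (psi (q x.1) x.2)); split.
- split.
    apply: (@discrete_pair_continuous P T E (fun p t => act (a p) (psi (q p) t))).
    by move=> p; exact: (continuousT_comp (cpsi (q p)) (@act_cont N E (a p))).
  by move=> n [p t] /=; rewrite aM qM actM.
- move=> p s /=; rewrite psig -eg; congr (g (_, _)); exact: aq.
- move=> [p t] /=; rewrite ee psib -eb; congr (b (_, _)); exact: aq.
Qed.

Lemma projective_discrete_extension (E B : nspaceType N) (e : E -> B)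
    (b : discrete_nspace N P -> B) :
  nmap e -> nmap b -> (forall q, exists z, e z = b q) ->
  exists k : discrete_nspace N P -> E, nmap k /\ forall x, e (k x) = b x.
Proof.
move=> [ce ee] [cb eb] /choice[psi psib].
have [a [q [aq aM qM]]] := projective_retract projP.
exists (fun p => act (a p) (psi (q p))); split.
  split; first by apply/continuousP => U _; exact: (@discrete_open (discrete_topology P)).
  by move=> n p /=; rewrite aM qM actM.
by move=> p; rewrite ee psib -eb; congr (b _); exact: aq.
Qed.

End projective_cells.

Section skeleta.
Variables (R : realType) (N : monoidType) (X : projective_cw R N).

Lemma cw_incl_nmap n : nmap (@cw_incl R N X n).
Proof. by have [[_ h _] _] := @cw_colimit R N X; exact: h. Qed.

Lemma cw_incl_step n x : cw_incl (cw_step x) = @cw_incl R N X n x.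
Proof. by have [[_ _ h] _] := @cw_colimit R N X; exact: (congr1 (@^~ x) (h n)). Qed.

Lemma cw_step_nmap n : nmap (@cw_step R N X n).
Proof. by have [[]] := @cw_pushout R N X n. Qed.

Lemma cw_char_nmap n : nmap (@cw_char R N X n).
Proof. by have [[]] := @cw_pushout R N X n. Qed.

Lemma cw_step_attach n (q : cw_cells X n.+1) (v : unit_sphere R n.+1) :
  cw_step (cw_attach (q, v)) = cw_char (q, sphere_ball v) :> cw_skel X n.+1.
Proof. by have [[_ _ _ _ sq] _] := @cw_pushout R N X n; exact: (eq_compE sq (q, v)). Qed.

End skeleta.

(** The tower E_0 -> E_1 -> ... maps to B, and b : X -> B is lifted to the
tower, the n-skeleton going to E_n.  The hypotheses lift0 and liftS are the
extension problems for one vertex and for one cell, without any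
equivariance. *)
Section lifting.
Variables (R : realType) (N : monoidType) (X : projective_cw R N).
Variables (E : nat -> nspaceType N) (s : forall n, E n -> E n.+1).
Variables (B : nspaceType N) (e : forall n, E n -> B) (b : X -> B).
Arguments s : clear implicits.
Arguments e : clear implicits.
Hypotheses (ns : forall n, nmap (s n)) (ne : forall n, nmap (e n)).
Hypothesis es : forall n, e n.+1 \o s n = e n.
Hypothesis nb : nmap b.
Hypothesis lift0 : forall p : cw_cells X 0,
  exists z, e 0 z = b (cw_incl (cw_vertices p)).
Hypothesis liftS : forall n (q : cw_cells X n.+1) (g : unit_sphere R n.+1 -> E n),
  continuous g ->
  (forall v, e n (g v) = b (cw_incl (cw_char (q, sphere_ball v)))) ->
  exists h : unit_ball R n.+1 -> E n.+1,
    [/\ continuous h, forall v, h (sphere_ball v) = s n (g v)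
      & forall v, e n.+1 (h v) = b (cw_incl (cw_char (q, v)))].

Let lift n := {F : cw_skel X n -> E n | nmap F /\ e n \o F = b \o @cw_incl R N X n}.

Let base : lift 0.
Proof.
apply: cid; have [nv [w [nw vw wv]]] := @cw_vertices_iso R N X.
have [|k [nk ek]] := @projective_discrete_extension N _ (@cw_projective R N X 0)
  (E 0) B (e 0) (b \o @cw_incl R N X 0 \o @cw_vertices R N X) (ne 0) _ lift0.
  exact: (nmap_comp nv (nmap_comp (cw_incl_nmap X 0) nb)).
exists (k \o w); split; first exact: nmap_comp.
by apply/funext => x /=; rewrite ek /= wv.
Qed.

Let step n (F : lift n) :
  {G : lift n.+1 | sval G \o @cw_step R N X n = s n \o sval F}.
Proof.
case: F => F /= [nF eF]; apply: cid.
have po := @cw_pushout R N X n; have [[na nc nst nch sq] univ] := po.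
have eFE (x : cw_skel X n) : e n (F x) = b (cw_incl x) by exact: (congr1 (@^~ x) eF).
have ctr (q : cw_cells X n.+1) : continuous (fun v : unit_sphere R n.+1 =>
    (q, v) : discrete_nspace N (cw_cells X n.+1) * trivial_nspace N _).
  by apply: continuous_pairfun; [exact: cst_continuous | move=> x; exact: cvg_id].
have cg q := continuousT_comp (ctr q) (continuousT_comp na.1 nF.1).
have bg (q : cw_cells X n.+1) (v : unit_sphere R n.+1) :
    e n (F (cw_attach (q, v))) = b (cw_incl (cw_char (q, sphere_ball v))).
  by rewrite eFE -cw_step_attach cw_incl_step.
have [psi psiP] := choice (fun q => @liftS n q _ (cg q) (bg q)).
have [k [nk kg ek]] := @projective_extension N _ (@cw_projective R N X n.+1)
  (unit_sphere R n.+1) (unit_ball R n.+1) (@sphere_ball R n.+1)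
  (E n.+1) B (e n.+1) (s n \o F \o @cw_attach R N X n)
  (b \o @cw_incl R N X n.+1 \o @cw_char R N X n) psi
  (ne _) (nmap_comp na (nmap_comp nF (ns n)))
  (nmap_comp nch (nmap_comp (cw_incl_nmap X _) nb))
  (fun q => let: And3 h _ _ := psiP q in h)
  (fun q v => let: And3 _ h _ := psiP q in h v)
  (fun q v => let: And3 _ _ h := psiP q in h v).
have kF : (s n \o F) \o @cw_attach R N X n = k \o @cell_boundary R N _ n.+1.
  by apply/funext => -[p v]; rewrite /comp /= kg.
have [G [[nG Gi Gj] _]] := univ (E n.+1) (s n \o F) k (nmap_comp nF (ns n)) nk kF.
have eG : e n.+1 \o G = b \o @cw_incl R N X n.+1.
  apply: (pushout_top_unique po).
  - exact: (continuousT_comp nG.1 (ne _).1).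
  - exact: (continuousT_comp (cw_incl_nmap X _).1 nb.1).
  - apply/funext => x; rewrite /comp cw_incl_step -eFE.
    have -> : G (cw_step x) = s n (F x) by exact: (congr1 (@^~ x) Gi).
    exact: (congr1 (@^~ (F x)) (es n)).
  - apply/funext => x; rewrite /comp -[RHS]ek.
    by congr e; exact: (congr1 (@^~ x) Gj).
by exists (exist _ G (conj nG eG)).
Qed.

Lemma cw_lifting : exists F : forall n, cw_skel X n -> E n,
  [/\ forall n, nmap (F n),
      forall n, F n.+1 \o @cw_step R N X n = s n \o F n
    & forall n, e n \o F n = b \o @cw_incl R N X n].
Proof.
pose L := nat_rect lift base (fun n F => sval (step F)).
exists (fun n => sval (L n)); split=> n.
- exact: (svalP (L n)).1.
- exact: (svalP (step (L n))).
- exact: (svalP (L n)).2.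
Qed.
End lifting.

(** * Contractible components and cone extension *)

Section pointwise.
Context {T Y : topologicalType}.

Lemma near_preimage (f : T -> Y) (x : T) (U : set Y) :
  {for x, continuous f} -> open U -> U (f x) -> \forall y \near x, U (f y).
Proof. by move=> cf oU Ux; apply: cf; exact: open_nbhs_nbhs. Qed.

Lemma near_eq_continuous_at (f g : T -> Y) (x : T) :
  (\forall y \near x, f y = g y) -> {for x, continuous f} ->
  {for x, continuous g}.
Proof.
move=> fg; rewrite /prop_for /continuous_at -(nbhs_singleton fg) => cf.
by apply: cvg_trans cf; exact: near_eq_cvg.
Qed.

(** Pointwise form of gluing along a closed cover; g1 and g2 need to be
continuous at x only if x lies in the corresponding closed set. *)
Lemma closed_cover_continuous_at (A B : set T) (g1 g2 g : T -> Y) (x : T) :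
  closed A -> closed B -> (forall y, A y \/ B y) ->
  (\forall y \near x, A y -> g y = g1 y) ->
  (\forall y \near x, B y -> g y = g2 y) ->
  (A x -> {for x, continuous g1}) -> (B x -> {for x, continuous g2}) ->
  {for x, continuous g}.
Proof.
move=> cA cB AB gA gB c1 c2 U Ux.
have nA : \forall y \near x, A y -> U (g y).
  have [Ax|Ax] := pselect (A x).
    have := c1 Ax U; rewrite -(nbhs_singleton gA Ax) => /(_ Ux) U1.
    by apply: filterS2 gA U1 => y + + Ay => -> //.
  by apply: filterS (open_nbhs_nbhs (conj (closed_openC cA) Ax)) => y.
have nB : \forall y \near x, B y -> U (g y).
  have [Bx|Bx] := pselect (B x).
    have := c2 Bx U; rewrite -(nbhs_singleton gB Bx) => /(_ Ux) U1.
    by apply: filterS2 gB U1 => y + + By => -> //.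
  by apply: filterS (open_nbhs_nbhs (conj (closed_openC cB) Bx)) => y.
apply: filterS2 nA nB => y Ay By /=.
by case: (AB y).
Qed.

End pointwise.

Lemma continuous_at_pair (T Y Z : topologicalType) (f : T -> Y) (g : T -> Z) (x : T) :
  {for x, continuous f} -> {for x, continuous g} ->
  {for x, continuous (fun y => (f y, g y))}.
Proof. by move=> cf cg; exact: (cvg_pair cf cg). Qed.

Section interval.
Variable R : realType.

Lemma clamp01_subproof (t : R) : Num.max 0 (Num.min t 1) \in `[0 : R, 1]%classic.
Proof.
rewrite inE /= in_itv /= le_max lexx /= ge_max ler01 /=.
by rewrite ge_min lexx orbT.
Qed.
Definition clamp01 (t : R) : unit_interval R :=
  exist (fun t : R => t \in `[0 : R, 1]%classic) _ (clamp01_subproof t).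

Lemma clamp01_continuous : continuous clamp01.
Proof.
apply: (@continuous_comp_initial _ _ _ (val : unit_interval R -> R)) => t.
apply: (@continuous_max R R (fun=> 0) (fun t => Num.min t 1)) => //.
  exact: cvg_cst.
by apply: (@continuous_min R R id (fun=> 1)) => //; exact: cvg_cst.
Qed.

Lemma val_interval_continuous : continuous (val : unit_interval R -> R).
Proof. exact: initial_continuous. Qed.

Lemma clamp01K (t : unit_interval R) : clamp01 (val t) = t.
Proof.
apply: val_inj => /=.
have := valP t; rewrite inE /= in_itv /= => /andP[t0 t1].
by rewrite (min_idPl t1) (max_idPr t0).
Qed.

Lemma clamp01_le0 (t : R) : t <= 0 -> clamp01 t = I0 R.
Proof.
by move=> t0; apply: val_inj => /=; apply/max_idPl; rewrite ge_min t0.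
Qed.

Lemma clamp01_ge1 (t : R) : 1 <= t -> clamp01 t = I1 R.
Proof.
move=> t1; apply: val_inj => /=; rewrite (min_idPr t1).
by apply/max_idPr; exact: ler01.
Qed.

Lemma affine_continuous (a b : R) : continuous (fun r : R => a - b * r).
Proof.
move=> r; apply: (@continuousB R R R (fun=> a) (fun r => b * r)).
  exact: cst_continuous.
exact: mulrl_continuous.
Qed.

End interval.

Section contractible_components.
Variable R : realType.

Lemma path_related_map (X Y : topologicalType) (f : X -> Y) (x y : X) :
  continuous f -> path_related R x y -> path_related R (f x) (f y).
Proof.
move=> cf [g [cg g0 g1]]; exists (f \o g); split; last 2 first.
- by rewrite /= g0.
- by rewrite /= g1.
exact: continuousT_comp.
Qed.

Lemma path_related_component (Y : topologicalType) (x y : Y) :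
  path_related R x y -> connected_component [set: Y] x y.
Proof.
move=> [g [cg g0 g1]]; have cgc := continuousT_comp (@clamp01_continuous R) cg.
have conn : connected ((g \o @clamp01 R) @` `[0, 1]).
  apply: connected_continuous_connected; first exact: segment_connected.
  exact: continuous_subspaceT.
apply: (connected_component_max _ _ conn) => //.
- by exists 0; rewrite /= ?in_itv /= ?lexx ?ler01 // clamp01_le0.
- by exists 1; rewrite /= ?in_itv /= ?lexx ?ler01 // clamp01_ge1.
Qed.

(** The model is T = R^n with rho the norm and g(x) = g0(x / |x|) for a map g0
on the unit sphere: then h extends g0 over the ball.  The contraction of the
component is run while rho decreases from 1 to 1/2, so that h is constant for
rho <= 1/2 and the points where rho = 0 need no separate study. *)
Lemma cone_extension (T Y : topologicalType) (y0 : Y) (rho : T -> R) (g : T -> Y) :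
  contractible R (connected_component [set: Y] y0) ->
  continuous rho -> (forall x, 0 < rho x -> {for x, continuous g}) ->
  (forall x, 0 < rho x -> path_related R y0 (g x)) ->
  exists h : T -> Y, continuous h /\ forall x, 1 <= rho x -> h x = g x.
Proof.
set C := connected_component _ _ => -[c0 [H [cH H0 H1]]] crho cg gC.
pose lift (y : Y) : C := insubd c0 y.
have liftK y : C y -> val (lift y) = y.
  by move=> Cy; rewrite /lift val_insubd mem_set.
have Cg x : 0 < rho x -> C (g x) by move=> /gC /path_related_component.
have clift x : 0 < rho x -> {for x, continuous (lift \o g)}.
  move=> rx U [_ [[V oV <-]] Vx] VU; rewrite /= in Vx.
  have Vgx : V (g x) by rewrite -(liftK _ (Cg _ rx)).
  have := near_preimage (cg x rx) oV Vgx.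
  have := near_preimage (crho x) (@open_gt R 0) rx.
  apply: filterS2 => y /= ry Vgy; apply: VU.
  rewrite /preimage /=; suff -> : set_val (lift (g y)) = g y by [].
  exact: (liftK _ (Cg _ ry)).
pose h x : Y := if 0 < rho x then val (H (lift (g x), clamp01 (2 - 2 * rho x)))
                else val c0.
exists h; split; last first.
  move=> x rx; rewrite /h (lt_le_trans ltr01 rx) clamp01_le0 ?H0; last first.
    by rewrite subr_le0 -[leLHS]mulr1 ler_wpM2l.
  by rewrite liftK //; apply: Cg; exact: lt_le_trans rx.
move=> x; have [rx|rx] := ltP 0 (rho x).
  apply: (@near_eq_continuous_at _ _
    (fun x => val (H (lift (g x), clamp01 (2 - 2 * rho x)))) h x).
    have := near_preimage (crho x) (@open_gt R 0) rx.
    by apply: filterS => y /= ry; rewrite /h ry.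
  apply: (@continuous_comp _ _ _ (fun x => (lift (g x), clamp01 (2 - 2 * rho x)))
           (fun z => val (H z))).
    apply: continuous_at_pair; first exact: (clift x rx).
    apply: (@continuous_comp _ _ _ (fun x => 2 - 2 * rho x)); last exact: clamp01_continuous.
    apply: continuousB; first exact: cst_continuous.
    by apply: continuousM; [exact: cst_continuous | exact: crho].
  by apply: continuous_comp; [exact: cH | exact: initial_continuous].
apply: (@near_eq_continuous_at _ _ (fun=> val c0)); last exact: cst_continuous.
have rx2 : rho x < 2^-1 by rewrite (le_lt_trans rx) // invr_gt0 ltr0n.
have := near_preimage (crho x) (@open_lt R 2^-1) rx2.
apply: filterS => y /= ry; rewrite /h; case: ifPn => // _.
rewrite clamp01_ge1 ?H1 // lerBrDr -lerBrDl.
rewrite [leRHS](_ : _ = 1); last by rewrite (natrD R 1 1) addrK.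
by rewrite mulrC -ler_pdivlMr ?ltr0n // div1r ltW.
Qed.

End contractible_components.

(** * The Euclidean norm and its projections *)

Section euclid.
Variable R : realType.

Definition enorm n (v : 'rV[R]_n) : R := Num.sqrt (\sum_i v ord0 i ^+ 2).

Lemma sumsq_ge0 n (v : 'rV[R]_n) : 0 <= \sum_i v ord0 i ^+ 2.
Proof. by apply: sumr_ge0 => i _; exact: sqr_ge0. Qed.

Lemma enorm_ge0 n (v : 'rV[R]_n) : 0 <= enorm v.
Proof. exact: sqrtr_ge0. Qed.

Lemma enorm_sqr n (v : 'rV[R]_n) : enorm v ^+ 2 = \sum_i v ord0 i ^+ 2.
Proof. by rewrite sqr_sqrtr // sumsq_ge0. Qed.

Lemma enormZ n (c : R) (v : 'rV[R]_n) : enorm (c *: v) = `|c| * enorm v.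
Proof.
rewrite /enorm; under eq_bigr do rewrite mxE exprMn.
by rewrite -mulr_sumr sqrtrM ?sqr_ge0 // sqrtr_sqr.
Qed.

Lemma enorm0 n : enorm (0 : 'rV[R]_n) = 0.
Proof. by rewrite -(scale0r (0 : 'rV[R]_n)) enormZ normr0 mul0r. Qed.

Lemma coord_le_enorm n (v : 'rV[R]_n) i : `|v ord0 i| <= enorm v.
Proof.
rewrite -sqrtr_sqr ler_sqrt ?sumsq_ge0 // (bigD1 i) //= lerDl.
by apply: sumr_ge0 => j _; exact: sqr_ge0.
Qed.

Lemma norm_le_enorm n (v : 'rV[R]_n) : `|v| <= enorm v.
Proof.
rewrite [leLHS]/Num.norm /= mx_normrE; apply/bigmax_leP; split; first exact: enorm_ge0.
by move=> [i j] _ /=; rewrite (ord1 i) coord_le_enorm.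
Qed.

Lemma coord_le_norm n (v : 'rV[R]_n) i : `|v ord0 i| <= `|v|.
Proof.
by rewrite [leRHS]/Num.norm /= mx_normrE; apply/bigmax_geP; right; exists (ord0, i).
Qed.

Lemma norm_le_coord n (v : 'rV[R]_n) (e : R) :
  0 <= e -> (forall i, `|v ord0 i| <= e) -> `|v| <= e.
Proof.
move=> e0 ve; rewrite [leLHS]/Num.norm /= mx_normrE; apply/bigmax_leP; split=> //.
by move=> [i j] _ /=; rewrite (ord1 i).
Qed.

Lemma enorm_le_norm n (v : 'rV[R]_n) : enorm v <= n.+1%:R * `|v|.
Proof.
rewrite -(@ler_pXn2r _ 2) ?nnegrE ?enorm_ge0 ?mulr_ge0 // enorm_sqr exprMn.
apply: (@le_trans _ _ (\sum_(i < n) `|v| ^+ 2)).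
  apply: ler_sum => i _; rewrite -real_normK ?num_real //.
  by rewrite ler_pXn2r ?nnegrE // coord_le_norm.
rewrite sumr_const card_ord -[leLHS]mulr_natl ler_wpM2r ?exprn_ge0 // -natrX ler_nat.
by rewrite (leq_trans (leqnSn n)) // -mulnn leq_pmulr.
Qed.

Lemma enorm_eq0 n (v : 'rV[R]_n) : (enorm v == 0) = (v == 0).
Proof.
apply/idP/idP => [/eqP v0|/eqP ->]; last by rewrite enorm0.
by rewrite -normr_eq0 eq_le normr_ge0 andbT -v0 norm_le_enorm.
Qed.

Lemma enorm_gt0 n (v : 'rV[R]_n) : (0 < enorm v) = (v != 0).
Proof. by rewrite lt_neqAle enorm_ge0 andbT eq_sym enorm_eq0. Qed.

Lemma enorm_continuous n : continuous (@enorm n).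
Proof.
apply: (@continuousT_comp _ _ _ (fun v : 'rV[R]_n => \sum_i v ord0 i ^+ 2) Num.sqrt); last first.
  exact: sqrt_continuous.
apply: continuous_big => [|i _].
  exact: add_continuous.
move=> v; apply: (@continuous_comp _ _ _ (fun v : 'rV[R]_n => v ord0 i) (fun x => x ^+ 2)).
  exact: coord_continuous.
exact: exprn_continuous.
Qed.

Lemma enorm_ball n (v : unit_ball R n) : enorm (val v) <= 1.
Proof.
have := valP v; rewrite inE /ball_set /= => vb.
by apply: (le_trans (ler_wsqrtr vb)); rewrite sqrtr1.
Qed.

Lemma enorm_sphere n (v : unit_sphere R n) : enorm (val v) = 1.
Proof. by have := valP v; rewrite inE /sphere_set /enorm /= => ->; rewrite sqrtr1. Qed.

Lemma val_ball_continuous n : continuous (val : unit_ball R n -> 'rV[R]_n).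
Proof. exact: initial_continuous. Qed.

Lemma ball_proj_subproof n (v : 'rV[R]_n) :
  (Num.max 1 (enorm v))^-1 *: v \in @ball_set R n.
Proof.
rewrite inE /ball_set /= -enorm_sqr expr_le1 ?enorm_ge0 // enormZ.
have m1 : 0 < Num.max 1 (enorm v) by rewrite lt_max ltr01.
rewrite gtr0_norm ?invr_gt0 // mulrC ler_pdivrMr // mul1r le_max lexx orbT //.
Qed.
(** The radial retraction of R^n onto the ball. *)
Definition ball_proj n (v : 'rV[R]_n) : unit_ball R n :=
  exist (fun v => v \in @ball_set R n) _ (ball_proj_subproof v).

Lemma ball_proj_continuous n : continuous (@ball_proj n).
Proof.
have cs v : {for v, continuous (fun v : 'rV[R]_n => (Num.max 1 (enorm v))^-1 *: v)}.
  apply: continuousZ; last exact: cvg_id.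
  apply: continuousV; first by rewrite gt_eqF // lt_max ltr01.
  apply: (@continuous_max R _ (fun=> 1) (@enorm n)); first exact: cst_continuous.
  exact: enorm_continuous.
apply: (@continuous_comp_initial _ _ _ (val : unit_ball R n -> 'rV[R]_n)) => v.
exact: cs.
Qed.

Lemma ball_proj_id n (v : 'rV[R]_n) : enorm v <= 1 -> val (ball_proj v) = v.
Proof. by move=> v1 /=; rewrite (max_idPl v1) invr1 scale1r. Qed.

Lemma ball_projK n (v : unit_ball R n) : ball_proj (val v) = v.
Proof. by apply: val_inj; rewrite ball_proj_id // enorm_ball. Qed.

Lemma sphere_proj_subproof n (v : 'rV[R]_n.+1) :
  (if v == 0 then delta_mx ord0 ord0 else (enorm v)^-1 *: v) \in @sphere_set R n.+1.
Proof.
rewrite inE /sphere_set /=; case: ifPn => v0.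
  rewrite (bigD1 ord0) //= big1 ?addr0 => [|i /negbTE i0]; first by rewrite mxE eqxx expr1n.
  by rewrite mxE i0 andbF expr0n.
by rewrite -enorm_sqr enormZ ger0_norm ?invr_ge0 ?enorm_ge0 // mulVf ?expr1n ?enorm_eq0.
Qed.
(** The map v |-> v / |v|; its value at 0 is an arbitrary point of the sphere,
so that the function is total. *)
Definition sphere_proj n (v : 'rV[R]_n.+1) : unit_sphere R n.+1 :=
  exist (fun v => v \in @sphere_set R n.+1) _ (sphere_proj_subproof v).

Lemma sphere_proj_continuous n (v : 'rV[R]_n.+1) :
  v != 0 -> {for v, continuous (@sphere_proj n)}.
Proof.
move=> v0 U [_ [[V oV <-]] /= Vv] VU.
have vp : 0 < enorm v by rewrite enorm_gt0.
have {}Vv : V ((enorm v)^-1 *: v) by move: Vv; rewrite set_valE /= (negbTE v0).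
have cs : {for v, continuous (fun v : 'rV[R]_n.+1 => (enorm v)^-1 *: v)}.
  apply: continuousZ; last exact: cvg_id.
  by apply: continuousV; [rewrite gt_eqF | exact: enorm_continuous].
have := near_preimage cs oV Vv.
have := near_preimage (@enorm_continuous n.+1 v) (@open_gt R 0) vp.
apply: filterS2 => w /=; rewrite enorm_gt0 => w0 Vw; apply: VU.
by rewrite /preimage /= set_valE /= (negbTE w0).
Qed.

Lemma sphere_projK n (v : unit_sphere R n.+1) : sphere_proj (val v) = v.
Proof.
apply: val_inj; rewrite /= ifF ?enorm_sphere ?invr1 ?scale1r //.
by apply/negbTE; rewrite -enorm_gt0 enorm_sphere.
Qed.

End euclid.

(** * Lipschitz maps to a higher-dimensional space *)

Section missing_point.
Variable R : realType.

Lemma nat_dist_lt1 (p q : nat) : `|p%:R - q%:R| < 1 :> R -> p = q.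
Proof.
move=> pq; apply/eqP; rewrite eqn_leq -(ltnS p) -(ltnS q) -!(ltr_nat R) -!natr1.
by move: pq; rewrite ltr_norml => /andP[lo hi]; apply/andP; split; lra.
Qed.

(** Divide the cube [-1, 1]^m into cells of side 1 / M: their images have
diameter at most L / M.  The grid of step e / Q in [0, e]^k has Q^k points.  If
L / M < e / Q, two grid points are never hit from the same cell, so not
all of them are hit if there are fewer cells than grid points.  With M = c * Q
and c > L / e fixed there are about (2 * c * Q)^m cells, which for large Q is
less than Q^k since m < k. *)
Lemma lipschitz_misses_point m k (w : 'rV[R]_m -> 'rV[R]_k) (L e : R) :
  (m < k)%N -> 0 <= L -> 0 < e ->
  (forall x y, `|x| <= 1 -> `|y| <= 1 -> `|w x - w y| <= L * `|x - y|) ->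
  exists z, `|z| <= e /\ forall x, `|x| <= 1 -> w x <> z.
Proof.
move=> mk L0 e0 lip; apply: contrapT => noz.
have hit z : `|z| <= e -> exists x, `|x| <= 1 /\ w x = z.
  move=> ze; apply: contrapT => nox; apply: noz; exists z; split=> // x x1 wx.
  by apply: nox; exists x.
pose c := (Num.truncn (L / e)).+1.
(* There are at most (2 M + 1)^m <= (3 c Q)^m cells, and (3 c)^m < Q. *)
pose Q := ((3 * c) ^ m).+1; pose M := (c * Q)%N.
have Lc : L < e * c%:R.
  by rewrite mulrC -ltr_pdivrMr //; exact: truncnS_gt.
have Q0 : 0 < Q%:R :> R by rewrite ltr0n.
have M0 : 0 < M%:R :> R by rewrite ltr0n muln_gt0.
pose grid (a : {ffun 'I_k -> 'I_Q}) : 'rV[R]_k := \row_i (e * (a i)%:R / Q%:R).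
have grid_le a : `|grid a| <= e.
  apply: norm_le_coord => [|i]; first exact: ltW.
  rewrite mxE ger0_norm; last by rewrite divr_ge0 ?mulr_ge0 // ltW.
  by rewrite ler_pdivrMr // ler_pM2l // ler_nat ltnW.
have [x xP] := choice (fun a => hit (grid a) (grid_le a)).
pose cell (x : 'rV[R]_m) : {ffun 'I_m -> 'I_(2 * M).+1} :=
  [ffun i => inord (Num.truncn ((x ord0 i + 1) * M%:R))].
have cell_near (y z : 'rV[R]_m) : `|y| <= 1 -> `|z| <= 1 -> cell y = cell z ->
    `|y - z| <= M%:R^-1.
  move=> y1 z1 yz; apply: norm_le_coord => [|i]; first by rewrite invr_ge0 ltW.
  have bd (u : 'rV[R]_m) : `|u| <= 1 ->
      0 <= (u ord0 i + 1) * M%:R /\ (Num.truncn ((u ord0 i + 1) * M%:R) < (2 * M).+1)%N.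
    move=> u1; have := le_trans (coord_le_norm u i) u1.
    rewrite ler_norml => /andP[lo hi].
    have nn : 0 <= (u ord0 i + 1) * M%:R.
      by apply: mulr_ge0; rewrite ?(ltW M0) // -lerBlDr sub0r.
    split=> //; rewrite ltnS -(ler_nat R).
    move: (nn); rewrite -truncn_le => /le_trans; apply; rewrite natrM ler_wpM2r ?(ltW M0) //.
    by rewrite (natrD R 1 1) lerD2r.
  have [y0 yM] := bd y y1; have [z0 zM] := bd z z1.
  have := congr1 (fun f : {ffun _ -> _} => nat_of_ord (f i)) yz.
  rewrite !ffunE !inordK // => tyz.
  have /andP[ya yb] := truncn_itv y0; have /andP[za zb] := truncn_itv z0.
  rewrite tyz in ya yb; rewrite !mxE.
  rewrite -(ler_pM2r M0) mulVf ?gt_eqF // -[X in _ * X](gtr0_norm M0) -normrM.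
  rewrite [X in `|X|](_ : _ = (y ord0 i + 1) * M%:R - (z ord0 i + 1) * M%:R); last first.
    by rewrite -mulrBl opprD addrACA subrr addr0.
  rewrite ler_norml; move: ya yb za zb; rewrite -natr1.
  move: ((y ord0 i + 1) * _) ((z ord0 i + 1) * _) ((Num.truncn _)%:R : R) => p q r.
  by move=> *; apply/andP; split; lra.
(* Grid points hit from the same cell are closer than the grid step. *)
have inj : injective (fun a => cell (x a)).
  move=> a b ab; have [xa wa] := xP a; have [xb wb] := xP b.
  have := lip _ _ xa xb; rewrite wa wb => gab.
  have {}gab : `|grid a - grid b| <= L / M%:R.
    by apply: (le_trans gab); rewrite ler_wpM2l //; exact: cell_near.
  apply/ffunP => i; apply: val_inj => /=.
  have := le_trans (coord_le_norm (grid a - grid b) i) gab.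
  rewrite !mxE -mulrBl -mulrBr normrM normfV normrM (gtr0_norm e0) (gtr0_norm Q0).
  rewrite ler_pdivrMr // => ab1.
  have ab2 : `|(a i)%:R - (b i)%:R| < 1 :> R.
    rewrite -(ltr_pM2l e0) mulr1; apply: (le_lt_trans ab1).
    have c0 : 0 < c%:R :> R by rewrite ltr0n.
    have -> : L / M%:R * Q%:R = L / c%:R.
      by rewrite /M natrM; field; rewrite !gt_eqF.
    by rewrite ltr_pdivrMr.
  exact: nat_dist_lt1 ab2.
have := leq_card _ inj; rewrite !card_ffun !card_ord leqNgt => /negP; apply.
have Q1 : (1 < Q)%N by rewrite /Q ltnS expn_gt0.
apply: (@leq_trans (Q ^ m.+1)); last by rewrite leq_exp2l.
apply: (@leq_ltn_trans ((3 * c * Q) ^ m)).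
  have [->//|m0] := posnP m.
  rewrite leq_exp2r // /M; have : (0 < c * Q)%N by rewrite muln_gt0.
  by rewrite -mulnA; move: (c * Q)%N => x1; lia.
by rewrite expnMn expnS ltn_pmul2r ?expn_gt0.
Qed.

(** Near the zeros of d the inequality holds because f < e there; away
from them, because f is bounded and d is bounded below by a positive
constant.  With f(x, y) = |v x - v y| and
d(x, y) = |x - y| this says that a continuous map is Lipschitz up to e. *)
Lemma compact_linear_bound (T : topologicalType) (K : set T) (f d : T -> R) (e : R) :
  compact K -> continuous f -> continuous d -> 0 < e ->
  (forall x, 0 <= d x) -> (forall x, d x = 0 -> f x <= 0) ->
  exists L, 0 < L /\ forall x, K x -> f x <= e + L * d x.
Proof.
move=> /compact_near_coveringP cK cf cd e0 d0 fd.
have [L [L0 LP]] : \forall L \near +oo, forall x, K x -> f x <= e + L * d x.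
  apply: cK => x Kx.
  have [dx|dx] := eqVneq (d x) 0.
    near=> y L => /=.
    have : 0 < L by near: L; apply: nbhs_pinfty_gt; exact: num_real.
    have : f y < e.
      near: y; apply: (near_preimage (cf x) (@open_lt R e)).
      by rewrite /= (le_lt_trans (fd _ dx)).
    have := d0 y; nra.
  have {}dx : 0 < d x by rewrite lt_neqAle eq_sym dx d0.
  near=> y L => /=.
  have : f y < `|f x| + 1.
    near: y; apply: (near_preimage (cf x) (@open_lt R _)).
    by rewrite /= (le_lt_trans (ler_norm _)) // ltrDl.
  have : d x / 2 < d y.
    near: y; apply: (near_preimage (cd x) (@open_gt R _)).
    by rewrite /= ltr_pdivrMr // ltr_pMr // ltr1n.
  have : (`|f x| + 1) / (d x / 2) < L by near: L; apply: nbhs_pinfty_gt; exact: num_real.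
  rewrite ltr_pdivrMr ?divr_gt0 // => h1 h2 h3.
  have Lp : 0 < L by near: L; apply: nbhs_pinfty_gt; exact: num_real.
  have : L * (d x / 2) < L * d y by rewrite ltr_pM2l.
  by move: h1 h3 e0; lra.
exists (Num.max 1 (L + 1)); split; first by rewrite lt_max ltr01.
by move=> x Kx; apply: LP Kx; rewrite lt_max ltrDl ltr01 orbT.
Unshelve. all: by end_near. Qed.

Lemma unit_norm_ball_compact m : compact [set x : 'rV[R]_m | `|x| <= 1].
Proof.
apply: bounded_closed_compact.
  exists 1; split; first exact: num_real.
  by move=> M M1 x Kx; apply: (le_trans Kx); exact: ltW.
apply: (@preimage_closed _ _ (fun x : 'rV[R]_m => `|x|) [set r | r <= 1]).
  by move=> x _; exact: norm_continuous.
exact: closed_le.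
Qed.

(** Each coordinate is replaced by the largest L-Lipschitz function below it
on the unit ball, its inf-convolution with L * |x|. *)
Lemma lipschitz_approximation m k (v : 'rV[R]_m -> 'rV[R]_k) (e : R) :
  continuous v -> 0 < e ->
  exists (w : 'rV[R]_m -> 'rV[R]_k) (L : R),
    [/\ 0 < L, forall x y, `|w x - w y| <= L * `|x - y|
      & forall x, `|x| <= 1 -> `|w x - v x| <= e].
Proof.
move=> cv e0; pose K := [set x : 'rV[R]_m | `|x| <= 1].
have cK : compact K by exact: unit_norm_ball_compact.
have cdist (p : nat) (u : 'rV[R]_m -> 'rV[R]_p) : continuous u ->
    continuous (fun z : 'rV[R]_m * 'rV[R]_m => `|u z.1 - u z.2|).
  move=> cu z; apply: cvg_norm; apply: cvgB.
    by apply: continuous_comp; [exact: cvg_fst|exact: cu].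
  by apply: continuous_comp; [exact: cvg_snd|exact: cu].
have diag (z : 'rV[R]_m * 'rV[R]_m) : `|id z.1 - id z.2| = 0 -> `|v z.1 - v z.2| <= 0.
  by move/eqP; rewrite normr_eq0 subr_eq0 => /eqP /= ->; rewrite subrr normr0.
have [L [L0 LP]] := compact_linear_bound (compact_setX cK cK) (cdist _ _ cv)
  (cdist _ _ (fun x => cvg_id)) e0 (fun z => normr_ge0 _) diag.
pose S i x := [set v y ord0 i + L * `|x - y| | y in K].
have K0 : K 0 by rewrite /K /= normr0.
have vL i x y : K x -> K y -> v x ord0 i <= e + (v y ord0 i + L * `|x - y|).
  move=> Kx Ky; have := LP (x, y) (conj Kx Ky) => /=.
  move=> /(le_trans (coord_le_norm _ i)); rewrite !mxE => /(le_trans (ler_norm _)).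
  lra.
have Slb i x : has_lbound (S i x).
  exists (v 0 ord0 i - e - L) => _ [y Ky <-].
  have := vL i _ _ K0 Ky; rewrite sub0r normrN.
  have : L * `|y| <= L by rewrite ger_pMr.
  have : 0 <= L * `|x - y| by rewrite mulr_ge0 // ltW.
  lra.
have Sne i x : S i x !=set0 by exists (v 0 ord0 i + L * `|x - 0|); exists 0.
pose w x := \row_i inf (S i x).
exists w, L; split=> //.
- move=> x y.
  have half i z z' : inf (S i z) <= inf (S i z') + L * `|z - z'|.
    rewrite -lerBlDr; apply: lb_le_inf => // _ [y' Ky' <-].
    rewrite lerBlDr -addrA -mulrDr [X in _ * X]addrC.
    apply: (@le_trans _ _ (v y' ord0 i + L * `|z - y'|)).
      by apply: ge_inf => //; exists y'.
    by rewrite lerD2l ler_pM2l // ler_distD.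
  apply: norm_le_coord => [|i]; first by rewrite mulr_ge0 // ltW.
  rewrite !mxE ler_norml; have := half i x y; have := half i y x.
  by rewrite (distrC y x) => *; apply/andP; split; lra.
- move=> x x1; apply: norm_le_coord => [|i]; first exact: ltW.
  have up : inf (S i x) <= v x ord0 i.
    by apply: ge_inf => //; exists x => //; rewrite subrr normr0 mulr0 addr0.
  have lo : v x ord0 i - e <= inf (S i x).
    by apply: lb_le_inf => // _ [y Ky <-]; rewrite lerBlDl; exact: vL.
  by rewrite !mxE ler_norml; apply/andP; split; lra.
Qed.

Lemma lipschitz_continuous m k (w : 'rV[R]_m -> 'rV[R]_k) (L : R) :
  0 < L -> (forall x y, `|w x - w y| <= L * `|x - y|) -> continuous w.
Proof.
move=> L0 lip x; rewrite /continuous_at; apply/(@cvgrPdist_lt _ _ _ (nbhs x) _ w (w x)) => e e0.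
have eL : 0 < e / L by rewrite divr_gt0.
apply: filterS (nbhsx_ballx x _ eL) => y; rewrite -ball_normE /= => xy.
by apply: (le_lt_trans (lip x y)); rewrite mulrC -ltr_pdivlMr.
Qed.

Lemma nonvanishing_approximation m k (v : 'rV[R]_m -> 'rV[R]_k) (e : R) :
  (m < k)%N -> continuous v -> 0 < e ->
  exists w : 'rV[R]_m -> 'rV[R]_k, continuous w /\
    forall x, `|x| <= 1 -> `|w x - v x| <= e /\ w x != 0.
Proof.
move=> mk cv e0; have e2 : 0 < e / 2 by rewrite divr_gt0.
have [w [L [L0 lip wv]]] := lipschitz_approximation cv e2.
have [z [ze wz]] := lipschitz_misses_point mk (ltW L0) e2 (fun x y _ _ => lip x y).
exists (fun x => w x - z); split=> [x|x x1].
  have cw := lipschitz_continuous L0 lip.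
  exact: (@continuousB _ _ _ w (fun=> z) x (cw x) (@cst_continuous _ _ z x)).
split; last by rewrite subr_eq0; apply/eqP; exact: wz.
rewrite addrAC; apply: (le_trans (ler_normB _ _)).
by rewrite [leRHS]splitr; apply: lerD => //; exact: wv.
Qed.

End missing_point.

(** * Attaching cells *)

Lemma near_open (T : topologicalType) (S : set T) :
  (forall x, S x -> \forall y \near x, S y) -> open S.
Proof. by rewrite openE => h x Sx; exact: h. Qed.

Section cell_attachment.
Variables (R : realType) (N : monoidType) (P : nsetType N) (n : nat).
Variables (B D : nspaceType N).
Local Notation sphere_cells :=
  (discrete_nspace N P * trivial_nspace N (unit_sphere R n.+1))%type.
Local Notation ball_cells :=
  (discrete_nspace N P * trivial_nspace N (unit_ball R n.+1))%type.
Variables (f : sphere_cells -> B) (i : B -> D) (j : ball_cells -> D).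
Hypothesis po : nspace_pushout f (@cell_boundary R N P n.+1) i j.

Let vec (x : ball_cells) : 'rV[R]_n.+1 := val (x.2 : unit_ball R n.+1).

Let vec_continuous : continuous vec.
Proof.
have c2 : continuous (snd : ball_cells -> unit_ball R n.+1).
  by move=> x; exact: cvg_snd.
exact: (continuousT_comp c2 (@val_ball_continuous R n.+1)).
Qed.

Let radius (x : ball_cells) : R := enorm (vec x).

Let radius_continuous : continuous radius.
Proof. exact: (continuousT_comp vec_continuous (@enorm_continuous R n.+1)). Qed.

Let radius_boundary (x : sphere_cells) : radius (cell_boundary x) = 1.
Proof. exact: enorm_sphere. Qed.

Let fcont : continuous f. Proof. by case: po => -[[]]. Qed.
Let jcont : continuous j. Proof. by case: po => -[_ _ _ []]. Qed.

(** This function equals 1 on B and is the distance to the centre in each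
cell. *)
Lemma attach_gauge : exists rho : D -> R, [/\ continuous rho,
  forall b, rho (i b) = 1 & forall x, rho (j x) = radius x].
Proof.
have [|rho [crho ri rj]] := pushout_top po (@cst_continuous B R 1) radius_continuous.
  by apply/funext => x; rewrite /comp radius_boundary.
by exists rho; split=> // x; [exact: (congr1 (@^~ x) ri)|exact: (congr1 (@^~ x) rj)].
Qed.

Definition gauge : D -> R := sval (cid attach_gauge).

Lemma gauge_continuous : continuous gauge.
Proof. by rewrite /gauge; case: cid => ? []. Qed.
Lemma gauge_i b : gauge (i b) = 1.
Proof. by rewrite /gauge; case: cid => ? []. Qed.
Lemma gauge_j x : gauge (j x) = radius x.
Proof. by rewrite /gauge; case: cid => ? []. Qed.

Lemma gauge_lt1 d : gauge d < 1 -> exists x, j x = d.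
Proof.
have [[b <-]|//] := pushout_surj po d.
by rewrite gauge_i ltxx.
Qed.

Let fproj (x : ball_cells) : B :=
  f (x.1, sphere_proj (vec x)).

Let fproj_continuous x : 0 < radius x -> {for x, continuous fproj}.
Proof.
move=> x0; apply: (@continuous_comp _ _ _
  (fun x : ball_cells => (x.1, sphere_proj (vec x)) : sphere_cells) f);
  last exact: fcont.
apply: continuous_at_pair; first exact: cvg_fst.
apply: (@continuous_comp _ _ _ vec); first exact: vec_continuous.
by apply: sphere_proj_continuous; rewrite -enorm_gt0.
Qed.

(** The radial retraction of D minus the centres of the cells onto B.  It
exists as a function because D is a pushout of sets, and the set of points
outside the centres that it sends to a given open set is open because its
preimages in B and in the cells are. *)
Lemma attach_retraction : exists u : D -> B, [/\ forall b, u (i b) = b,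
  forall O, open O -> open [set d | 0 < gauge d /\ O (u d)]
  & forall d, 0 < gauge d -> {for d, continuous u}].
Proof.
have [|u [_ ui uj]] := pushout_top po
    (@indiscrete_continuous _ _ (id : B -> indiscrete B))
    (@indiscrete_continuous _ _ (fproj : ball_cells -> indiscrete B)).
  apply/funext => -[p v]; rewrite /comp /fproj /cell_boundary /=.
  by rewrite sphere_projK.
have uiE b : u (i b) = b by exact: (congr1 (@^~ b) ui).
have ujE x : u (j x) = fproj x by exact: (congr1 (@^~ x) uj).
have oW (O : set B) : open O -> open [set d | 0 < gauge d /\ O (u d)].
  move=> oO; apply: (pushout_open po).
    rewrite (_ : i @^-1` _ = O); first exact: oO.
    by apply/seteqP; split=> b /=; rewrite gauge_i uiE; [case|split].
  apply: near_open => x [/=]; rewrite gauge_j ujE => x0 Ox.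
  apply: filterS2 (near_preimage (@radius_continuous x) (@open_gt R 0) x0)
    (near_preimage (fproj_continuous x0) oO Ox).
  by move=> y y0 Oy; split; [rewrite gauge_j | rewrite ujE].
exists u; split=> // d d0 U; rewrite nbhsE; case=> O [oO Od] OU.
have : nbhs d [set d | 0 < gauge d /\ O (u d)].
  by apply: open_nbhs_nbhs; split; [exact: oW|].
by apply: filterS => y [_ /OU].
Qed.

Lemma attach_open_extension (O : set B) : open O ->
  exists2 O' : set D, open O' & i @^-1` O' = O.
Proof.
have [u [ui oW _]] := attach_retraction.
move=> /oW oO; eexists; first exact: oO.
by apply/seteqP; split=> b /=; rewrite gauge_i ui; [case|split].
Qed.

(** The inverse of the characteristic map on open cells, extended arbitrarily
to the rest of D. *)
Lemma attach_chart (x0 : ball_cells) : exists c : D -> ball_cells,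
  (forall d, gauge d < 1 -> j (c d) = d) /\
  forall d, gauge d < 1 -> {for d, continuous c}.
Proof.
pose k x : indiscrete (option ball_cells) := if radius x < 1 then Some x else None.
have [|u [_ ui uj]] := pushout_top po
    (@indiscrete_continuous _ _ ((fun=> None) : B -> indiscrete (option ball_cells)))
    (@indiscrete_continuous _ _ k).
  by apply/funext => x; rewrite /comp /k radius_boundary ltxx.
have ujE x : radius x < 1 -> u (j x) = Some x.
  by move=> x1; rewrite (congr1 (@^~ x) uj : u (j x) = k x) /k x1.
pose c d := odflt x0 (u d : option ball_cells).
have cj x : radius x < 1 -> c (j x) = x by rewrite /c => /ujE ->.
exists c; split=> d d1.
  by have [x xd] := gauge_lt1 d1; rewrite -xd cj // -gauge_j xd.
move=> U; rewrite nbhsE; case=> O [oO Od] OU.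
have oW : open [set d | gauge d < 1 /\ O (c d)].
  apply: (pushout_open po).
    rewrite (_ : _ @^-1` _ = set0); first exact: open0.
    by apply/seteqP; split=> b //= -[]; rewrite gauge_i ltxx.
  apply: near_open => x [/=]; rewrite gauge_j => x1; rewrite cj // => Ox.
  have nO : \forall y \near x, O y by exact: open_nbhs_nbhs.
  apply: filterS2 nO (near_preimage (@radius_continuous x) (@open_lt R 1) x1).
  by move=> y Oy y1; split; [rewrite gauge_j | rewrite cj].
have : nbhs d [set d | gauge d < 1 /\ O (c d)] by exact: open_nbhs_nbhs.
by apply: filterS => y [_ /OU].
Qed.

(** The coordinate in the cells is multiplied by a cutoff that is 1 near the
centres and 0 on the boundary spheres.  Contrary to the chart, the result is
continuous on all of D, and therefore it can be approximated on a whole ball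
mapped to D. *)
Lemma attach_coordinate : exists kappa : D -> 'rV[R]_n.+1, continuous kappa /\
  forall x, radius x <= 4^-1 -> kappa (j x) = vec x.
Proof.
pose l (r : R) : R := Num.min 1 (2 - 2 * r).
have cl : continuous l.
  move=> r; apply: (@continuous_min R R (fun=> 1) (fun r => 2 - 2 * r)).
    exact: cst_continuous.
  exact: affine_continuous.
pose k (x : ball_cells) := l (radius x) *: vec x.
have ck : continuous k.
  move=> x; apply: (@continuousZ _ _ _ (l \o radius) vec).
    exact: (continuousT_comp radius_continuous cl).
  exact: vec_continuous.
have [|u [cu _ uj]] := pushout_top po (Z := 'rV[R]_n.+1)
  (@cst_continuous B 'rV[R]_n.+1 0) ck.
  apply/funext => x; rewrite /comp /k radius_boundary /l mulr1 subrr.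
  by rewrite (min_idPr ler01) scale0r.
exists u; split=> // x x4; rewrite (congr1 (@^~ x) uj : u (j x) = k x) /k /l.
by rewrite (min_idPl _) ?scale1r //; lra.
Qed.

(** In a cell, a multiple of 1 - radius is added to a radial extension of
tau that is cut off near the centre; it vanishes on the boundary, and the
constant c is chosen to give the prescribed value at d0. *)
Lemma attach_height (tau : B -> R) (d0 : D) (K : R) : continuous tau ->
  ~ range i d0 -> exists tau' : D -> R,
    [/\ continuous tau', forall b, tau' (i b) = tau b & tau' d0 = K].
Proof.
move=> ctau d0i; have [[b bd0]|[x0 x0d0]] := pushout_surj po d0.
  by case: d0i; exists b.
(* A point of the boundary of a cell would be in the image of B. *)
have r0 : radius x0 < 1.
  rewrite lt_neqAle enorm_ball andbT; apply/eqP => r1; apply: d0i.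
  have s1 : vec x0 \in @sphere_set R n.+1.
    by rewrite inE /sphere_set /= -enorm_sqr -/(radius x0) r1 expr1n.
  pose s : unit_sphere R n.+1 := exist _ (vec x0) s1.
  exists (f (x0.1, s)) => //; case: po => -[_ _ _ _ sq] _.
  rewrite -x0d0 (eq_compE sq); congr j.
  have -> : x0 = (x0.1, x0.2) by case: (x0).
  by congr pair; exact: val_inj.
pose a x := Num.max 0 (2 * radius x - 1).
pose c := (K - a x0 * tau (fproj x0)) / (1 - radius x0).
pose k x := a x * tau (fproj x) + (1 - radius x) * c.
have ca : continuous a.
  move=> x; apply: (@continuous_max R _ (fun=> 0) (fun x => 2 * radius x - 1)).
    exact: cst_continuous.
  apply: (@continuousB R R _ (fun x => 2 * radius x) (fun=> 1)); last exact: cst_continuous.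
  by apply: continuous_comp; [exact: radius_continuous|exact: mulrl_continuous].
have c2 x : {for x, continuous (fun x => (1 - radius x) * c)}.
  apply: (@continuousM _ _ (fun x => 1 - radius x) (fun=> c)); last exact: cst_continuous.
  apply: (@continuousB R R _ (fun=> 1) radius); first exact: cst_continuous.
  exact: radius_continuous.
have ck : continuous k.
  move=> x; have [x1|x1] := ltP 0 (radius x).
    apply: (@continuousD R R _ (fun x => a x * tau (fproj x)) (fun x => (1 - radius x) * c));
      last exact: c2.
    apply: (@continuousM _ _ a (tau \o fproj)); first exact: ca.
    by apply: continuous_comp; [exact: fproj_continuous|exact: ctau].
  apply: near_eq_continuous_at (c2 x).
  have x2 : radius x < 2^-1 by apply: le_lt_trans x1 _; rewrite invr_gt0 ltr0n.
  apply: filterS (near_preimage (@radius_continuous x) (@open_lt R 2^-1) x2) => y /= y2.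
  rewrite /k /a (max_idPl _) ?mul0r ?add0r //; lra.
have [|u [cu ui uj]] := pushout_top po (Z := R) ctau ck.
  apply/funext => x; rewrite /comp /k /a radius_boundary subrr mul0r addr0.
  rewrite (max_idPr _); last lra.
  rewrite (_ : 2 * 1 - 1 = 1); last lra.
  rewrite mul1r /fproj /cell_boundary; case: x => p v /=.
  by congr (tau (f (_, _))); rewrite sphere_projK.
exists u; split=> // [b|]; first exact: (congr1 (@^~ b) ui).
rewrite -x0d0 (congr1 (@^~ x0) uj : u (j x0) = k x0) /k /c.
by rewrite [X in _ + X]mulrC divfK ?subr_eq0 ?gt_eqF // addrC subrK.
Qed.

(** Only the extension psi is claimed, not a homotopy from phi to i \o psi.
Inside the cells, phi is moved so as to avoid the centres, and then retracted
radially to B.  The motion replaces the coordinate b(x) of phi(x) by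
b(x) + mu * (w(x) - kap(x)), where kap is the global coordinate, w is a
nowhere zero approximation of kap and mu decreases from 1 to 0 when the
radius goes from 1/4 to 1/2.  Where the radius is at most 1/4, the new
coordinate is w, which is nonzero; elsewhere the error w - kap is smaller
than b. *)
Lemma compression m (phi : unit_ball R m -> D) (g : unit_sphere R m -> B) :
  (m < n.+1)%N -> continuous phi -> (forall s, i (g s) = phi (sphere_ball s)) ->
  exists psi : unit_ball R m -> B,
    continuous psi /\ forall s, psi (sphere_ball s) = g s.
Proof.
move=> mn cphi gphi; have [u [ui _ uc]] := attach_retraction.
have [[z z1]|nz] := pselect (exists z, gauge (phi z) < 1); last first.
  exists (u \o phi); split=> [x|s]; last by rewrite /= -gphi ui.
  apply: continuous_comp; first exact: cphi.
  apply: uc; apply: lt_le_trans (ltr01) _; rewrite leNgt.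
  by apply/negP => x1; apply: nz; exists x.
have [x0 _] := gauge_lt1 z1; have [c [jc cc]] := attach_chart x0.
have [kap [ckap kapE]] := attach_coordinate.
pose Phi (x : 'rV[R]_m) := phi (ball_proj x).
have cPhi : continuous Phi by exact: (continuousT_comp (@ball_proj_continuous R m) cphi).
have cr : continuous (gauge \o Phi) by exact: (continuousT_comp cPhi gauge_continuous).
have cv : continuous (kap \o Phi) by exact: (continuousT_comp cPhi ckap).
(* The Euclidean norm is at most n + 2 times the sup norm, so that an error e
   in sup norm is an error of at most 1/8 in Euclidean norm. *)
pose e : R := (8 * n.+2%:R)^-1.
have e0 : 0 < e by rewrite invr_gt0 mulr_gt0 // ltr0n.
have [w [cw wP]] := nonvanishing_approximation mn cv e0.
pose mu (r : R) : R := val (clamp01 (2 - 4 * r)).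
have cmu : continuous mu.
  exact: (continuousT_comp (continuousT_comp (@affine_continuous R 2 4)
    (@clamp01_continuous R)) (@val_interval_continuous R)).
pose b x : 'rV[R]_n.+1 := vec (c (Phi x)).
pose y x := b x + mu (gauge (Phi x)) *: (w x - kap (Phi x)).
pose J x := j ((c (Phi x)).1, ball_proj (y x)).
pose Phi' x := if gauge (Phi x) < 1 then J x else Phi x.
have cJ x : gauge (Phi x) < 1 -> {for x, continuous J}.
  move=> x1; have ccx : {for x, continuous (c \o Phi)}.
    by apply: continuous_comp; [exact: cPhi|exact: cc].
  apply: (@continuous_comp _ _ _ (fun x => ((c (Phi x)).1, ball_proj (y x)) : ball_cells) j);
    last exact: jcont.
  apply: continuous_at_pair.
    by apply: (@continuous_comp _ _ _ (c \o Phi) fst); [exact: ccx|exact: cvg_fst].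
  apply: (@continuous_comp _ _ _ y); last exact: ball_proj_continuous.
  apply: (@continuousD _ _ _ b (fun x => mu (gauge (Phi x)) *: (w x - kap (Phi x)))).
    apply: (@continuous_comp _ _ _ (c \o Phi) vec); first exact: ccx.
    exact: vec_continuous.
  apply: continuousZ; first exact: (continuousT_comp cr cmu).
  by apply: (@continuousB _ _ _ w (kap \o Phi)); [exact: cw|exact: cv].
have JE x : 2^-1 < gauge (Phi x) -> gauge (Phi x) < 1 -> J x = Phi x.
  move=> x2 x1; rewrite /J /y /mu clamp01_le0; last by lra.
  rewrite scale0r addr0 ball_projK -[RHS](jc _ x1).
  by case: (c (Phi x)).
have cPhi' : continuous Phi'.
  move=> x; have [x1|x1] := ltP (gauge (Phi x)) 1.
    apply: (@near_eq_continuous_at _ _ J Phi' x _ (cJ x x1)).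
    apply: filterS (near_preimage (cr x) (@open_lt R 1) x1) => x' /= x'1.
    by rewrite /Phi' x'1.
  apply: (@near_eq_continuous_at _ _ Phi Phi' x _ (cPhi x)).
  have x2 : 2^-1 < (gauge \o Phi) x by rewrite /=; lra.
  apply: filterS (near_preimage (cr x) (@open_gt R 2^-1) x2) => x' /= x'2.
  by rewrite /Phi'; case: ifPn => // x'1; rewrite JE.
have pos (x : 'rV[R]_m) : `|x| <= 1 -> 0 < gauge (Phi' x).
  move=> x1; rewrite /Phi'; case: ifPn => [r1|]; last first.
    by rewrite -leNgt; apply: lt_le_trans.
  have [wk w0] := wP x x1; rewrite /= in wk.
  rewrite gauge_j /radius /= enormZ mulr_gt0 //.
    by rewrite normr_gt0 invr_eq0 gt_eqF // lt_max ltr01.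
  have bE : enorm (b x) = gauge (Phi x) by rewrite -[in RHS](jc _ r1) gauge_j.
  rewrite enorm_gt0; have [r4|r4] := leP (gauge (Phi x)) 4^-1.
    rewrite /y /mu clamp01_ge1 /=; last by lra.
    rewrite scale1r -[X in kap X](jc _ r1) kapE -?/(b x).
      by rewrite addrC subrK.
    by rewrite -/(radius _) -gauge_j jc.
  apply/eqP => /eqP; rewrite /y addr_eq0 => /eqP by0.
  have : enorm (b x) <= 8^-1.
    rewrite by0 -scaleN1r !enormZ normrN1 mul1r.
    have /andP[m0 m1] : 0 <= mu (gauge (Phi x)) <= 1.
      by rewrite /mu; have := valP (clamp01 (2 - 4 * gauge (Phi x))); rewrite inE /= in_itv.
    rewrite ger0_norm //; apply: (@le_trans _ _ (enorm (w x - kap (Phi x)))).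
      by rewrite ler_piMl ?enorm_ge0.
    apply: (le_trans (enorm_le_norm _)); rewrite mulrC -ler_pdivlMr ?ltr0n //.
    by apply: (le_trans wk); rewrite /e invfM.
  by rewrite bE; lra.
pose Psi (x : unit_ball R m) := Phi' (val x).
have cPsi : continuous Psi.
  exact: (continuousT_comp (@val_ball_continuous R m) cPhi').
exists (u \o Psi); split=> [x|s].
  apply: continuous_comp; first exact: cPsi.
  apply: uc; apply: pos; exact: le_trans (norm_le_enorm _) (enorm_ball _).
have PhiE : Phi (val (sphere_ball s)) = i (g s) by rewrite /Phi ball_projK gphi.
by rewrite /comp /Psi /Phi' PhiE gauge_i ltxx ui.
Qed.

End cell_attachment.

(** * Cellular approximation *)

Section towers.
Variables (R : realType) (N : monoidType).

(** Cells of dimension greater than m are attached.  The skeleta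
of a complex satisfy this for m <= n at step n; the bound is kept separate
from the index of the step so that towers can be shifted. *)
Definition cell_step (m : nat) (A A' : nspaceType N) (t : A -> A') :=
  exists (k : nat) (P : nsetType N) f j,
    (m < k.+1)%N /\ nspace_pushout f (@cell_boundary R N P k.+1) t j.

Lemma colimit_shift (S : nat -> nspaceType N) (t : forall n, S n -> S n.+1)
    (X : nspaceType N) (e : forall n, S n -> X) :
  nspace_colimit t e ->
  @nspace_colimit N (fun n => S n.+1) (fun n => t n.+1) X (fun n => e n.+1).
Proof.
move=> [[nt ne et] univ]; split; first by split=> n; [exact: nt|exact: ne|exact: et].
move=> Z h nh ht.
pose k n : S n -> Z := h n \o @t n.
have [||u [[nu ue] uu]] := univ Z k.
- by move=> n; exact: nmap_comp.
- by move=> n; apply/funext => x; exact: (congr1 (@^~ (@t n x)) (ht n)).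
have hE n x : u (e n.+1 x) = h n x.
  exact: (etrans (congr1 (@^~ x) (ue n.+1)) (congr1 (@^~ x) (ht n))).
exists u; split.
  by split=> // n; apply/funext => x; exact: hE.
move=> v [nv ve]; apply: uu; split=> // n.
apply/funext => x; rewrite /comp -(congr1 (@^~ x) (et n)).
exact: (congr1 (@^~ (@t n x)) (ve n)).
Qed.

(** An open set is extended step by step up the tower.  The case of
S K reduces to that of S 0 by dropping the first K terms. *)
Lemma tower_open_extension (K : nat) (S : nat -> nspaceType N)
    (t : forall n, S n -> S n.+1) (X : nspaceType N) (e : forall n, S n -> X) :
  nspace_colimit t e -> (forall n, cell_step 0 (@t n)) ->
  forall O : set (S K), open O -> exists2 O' : set X, open O' & @e K @^-1` O' = O.
Proof.
elim: K S t e => [|K IH] S t e colim steps O oO; last first.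
  exact: (IH _ _ _ (colimit_shift colim) (fun n => steps n.+1) O oO).
pose T n := {O : set (S n) | open O}.
have step n (U : T n) : {V : T n.+1 | @t n @^-1` sval V = sval U}.
  apply: cid; have [k [P [f [j [_ po]]]]] := steps n.
  have [V oV VU] := attach_open_extension po (svalP U).
  by exists (exist _ V oV).
pose U := nat_rect T (exist _ O oO) (fun n V => sval (step n V)).
have Ut n : @t n @^-1` sval (U n.+1) = sval (U n) by exact: (svalP (step n (U n))).
have [||u [cu ue]] := colimit_top colim (Z := sierpinski)
  (h := fun n x => `[< sval (U n) x >]).
- by move=> n; apply: sierpinski_continuous; exact: (svalP (U n)).
- by move=> n; apply/funext => x; exact: (congr1 (fun V : set (S n) => `[< V x >]) (Ut n)).
exists (u @^-1` [set true]); first exact: (continuous_preimage cu open_sierpinski_true).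
have u0 x : u (e 0 x) = `[< O x >] by exact: (congr1 (@^~ x) (ue 0)).
by apply/seteqP; split=> x /=; rewrite u0 => /asboolP.
Qed.

Section compactness.
Variables (S : nat -> nspaceType N) (t : forall n, S n -> S n.+1).
Variables (X : nspaceType N) (e : forall n, S n -> X).
Hypotheses (colim : nspace_colimit t e) (steps : forall n, cell_step 0 (@t n)).

Let range_mono m n : (m <= n)%N -> range (@e m) `<=` range (@e n).
Proof.
move=> /subnKC <-; elim: (n - m)%N => [|k IH]; first by rewrite addn0.
move=> x /IH [s _ <-]; rewrite addnS; exists (t s) => //.
by case: colim => -[_ _ et] _; exact: (congr1 (@^~ s) (et _)).
Qed.

(** Call n bad if some phi(x) lies in S (n+1) but not in S n.  If infinitely many
n are bad, the functions of attach_height glue to a real function on X that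
takes the value n at such a phi(x) for each bad n; it is unbounded on
phi(A), which is compact. *)
Lemma compact_tower (T : topologicalType) (A : set T) (phi : T -> X) :
  compact A -> continuous phi ->
  exists K, forall x, A x -> range (@e K) (phi x).
Proof.
move=> cA cphi.
pose bad n := exists x, [/\ A x, range (@e n.+1) (phi x) & ~ range (@e n) (phi x)].
have [[K Kgood]|allbad] := pselect (exists K, forall n, (K <= n)%N -> ~ bad n).
  exists K => x Ax; have [n [s es]] := colimit_surj colim (phi x).
  have : range (@e (n + K)) (phi x).
    by apply: (range_mono (leq_addr K n)); exists s.
  elim: n {s es} => [//|n IH] rn; apply: IH; apply: contrapT => nr.
  by apply: (Kgood (n + K)%N (leq_addl _ _)); exists x.
have pick n : {s : option (S n.+1) | if s is Some z
    then ~ range (@t n) z /\ exists x, A x /\ e z = phi x else ~ bad n}.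
  apply: cid; have [[x [Ax [z _ zx] nx]]|nb] := pselect (bad n); last by exists None.
  exists (Some z); split; last by exists x.
  move=> [y _ yz]; apply: nx; exists y => //; rewrite -zx -yz.
  by case: colim => -[_ _ et] _; rewrite -(et n).
pose H n := {tau : S n -> R | continuous tau}.
have step n (tau : H n) : {tau' : H n.+1 | sval tau' \o @t n = sval tau /\
    forall z, sval (pick n) = Some z -> sval tau' z = n%:R}.
  apply: cid; have [k [P [f [j [_ po]]]]] := steps n.
  case: (sval (pick n)) (svalP (pick n)) => [z [zt _]|_].
    have [tau' [ct ti tz]] := attach_height po n%:R (svalP tau) zt.
    exists (exist _ tau' ct); split; first exact/funext.
    by move=> z' [<-].
  (* No value is prescribed: any extension will do. *)
  have [[z zt]|nz] := pselect (exists z, ~ range (@t n) z).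
    have [tau' [ct ti _]] := attach_height po 0 (svalP tau) zt.
    by exists (exist _ tau' ct); split; first exact/funext.
  have [u [ui _ uc]] := attach_retraction po.
  have allt z : range (@t n) z by apply: contrapT => zt; apply: nz; exists z.
  have cu : continuous u.
    by move=> z; apply: uc; have [y _ <-] := allt z; rewrite gauge_i.
  exists (exist _ (sval tau \o u) (continuousT_comp cu (svalP tau))); split=> //.
  by apply/funext => y /=; rewrite ui.
have c0 : continuous (fun=> 0 : R) := @cst_continuous (S 0) R 0.
pose tau := nat_rect H (exist _ (fun=> 0) c0) (fun n h => sval (step n h)).
have tauS n := svalP (step n (tau n)).
have [||u [cu ue]] := colimit_top colim (Z := R) (h := fun n => sval (tau n)).
- by move=> n; exact: (svalP (tau n)).
- by move=> n; exact: (tauS n).1.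
have uz n z : sval (pick n) = Some z -> u (e z) = n%:R.
  by move=> /(tauS n).2 <-; exact: (congr1 (@^~ z) (ue n.+1)).
have [M [_ MP]] : bounded_set ((u \o phi) @` A).
  apply: compact_bounded; apply: continuous_compact => //.
  by apply: continuous_subspaceT; exact: continuousT_comp.
pose K := (Num.truncn (M + 1)).+1.
case: allbad; exists K => n Kn badn.
have := svalP (pick n); case pn : (sval (pick n)) => [z|//] [_ [x [Ax zx]]].
have : `|u (phi x)| <= M + 1.
  by apply: (MP (M + 1)); rewrite ?ltrDl ?ltr01 //; exists x.
rewrite -zx (uz n z pn) ger0_norm // leNgt => /negP; apply.
by apply: (lt_le_trans (truncnS_gt _)); rewrite ler_nat.
Qed.

End compactness.

Fixpoint climb (S : nat -> nspaceType N) (t : forall n, S n -> S n.+1)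
    (K : nat) : S 0 -> S K :=
  if K is K'.+1 then fun z => t K' (climb t K' z) else id.

Lemma climb_shift (S : nat -> nspaceType N) (t : forall n, S n -> S n.+1) K z :
  climb t K.+1 z = @climb (fun n => S n.+1) (fun n => t n.+1) K (t 0 z).
Proof. by elim: K => //= K ->. Qed.

Lemma climb_incl (S : nat -> nspaceType N) (t : forall n, S n -> S n.+1)
    (X : nspaceType N) (e : forall n, S n -> X) :
  (forall n, @e n.+1 \o @t n = @e n) -> forall K z, e K (climb t K z) = e 0 z.
Proof. by move=> et; elim=> // K IH z /=; rewrite -IH -(et K). Qed.

(** Iterated compression: the cells of dimension greater than m are removed
one dimension at a time. *)
Lemma descend (m K : nat) (S : nat -> nspaceType N) (t : forall n, S n -> S n.+1)
    (g : unit_sphere R m -> S 0) (phi : unit_ball R m -> S K) :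
  (forall n, cell_step m (@t n)) -> continuous phi ->
  (forall s, phi (sphere_ball s) = climb t K (g s)) ->
  exists psi : unit_ball R m -> S 0,
    continuous psi /\ forall s, psi (sphere_ball s) = g s.
Proof.
elim: K S t g phi => [|K IH] S t g phi steps cphi phig; first by exists phi.
have [psi [cpsi psig]] := IH (fun n => S n.+1) (fun n => t n.+1) (t 0 \o g) phi
  (fun n => steps n.+1) cphi (fun s => etrans (phig s) (climb_shift t K (g s))).
have [k [P [f [j [mk po]]]]] := steps 0.
exact: (compression po mk cpsi (fun s => esym (psig s))).
Qed.

(** A map from the ball to the colimit with boundary in S a factors
through some S K by compactness, and then descends to S a. *)
Lemma cellular_extension (m a : nat) (S : nat -> nspaceType N)
    (t : forall n, S n -> S n.+1) (X : nspaceType N) (e : forall n, S n -> X)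
    (g : unit_sphere R m -> S a) (phi : unit_ball R m -> X) :
  nspace_colimit t e -> (forall n, cell_step 0 (@t n)) ->
  (forall n, (a <= n)%N -> cell_step m (@t n)) ->
  continuous phi -> (forall s, phi (sphere_ball s) = e a (g s)) ->
  exists psi : unit_ball R m -> S a,
    continuous psi /\ forall s, psi (sphere_ball s) = g s.
Proof.
elim: a S t e g phi => [|a IH] S t e g phi colim steps stepsm cphi phig; last first.
  exact: (IH _ _ _ g phi (colimit_shift colim) (fun n => steps n.+1)
    (fun n an => stepsm n.+1 an) cphi phig).
pose Phi (x : 'rV[R]_m) := phi (ball_proj x).
have cPhi : continuous Phi by exact: (continuousT_comp (@ball_proj_continuous R m) cphi).
have cB : compact [set x : 'rV[R]_m | `|x| <= 1] by exact: unit_norm_ball_compact.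
have [K KP] := compact_tower colim steps cB cPhi.
have et : forall n, @e n.+1 \o @t n = @e n by case: colim => -[].
(* On the boundary the lift is prescribed, so that injectivity of the
   inclusions into X is not at stake. *)
have phiK v : exists z, e K z = phi v /\
    forall s, sphere_ball s = v -> z = climb t K (g s).
  have [[s sv]|ns] := pselect (exists s, sphere_ball s = v).
    exists (climb t K (g s)); rewrite climb_incl // -phig sv; split=> // s' s'v.
    congr (climb t K (g _)); apply: val_inj.
    by have := congr1 val (etrans sv (esym s'v)).
  have [z _ zv] : range (@e K) (phi v).
    rewrite -(ball_projK v); apply: KP => /=.
    exact: le_trans (norm_le_enorm _) (enorm_ball _).
  by exists z; split=> // s sv; case: ns; exists s.
have [phi' phi'P] := choice phiK.
apply: (@descend m K S t g phi') => [n||s]; [exact: stepsm| |by apply: (phi'P _).2].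
apply/continuousP => O oO.
have [V oV VO] := tower_open_extension colim steps oO.
rewrite (_ : phi' @^-1` O = phi @^-1` V); first exact: continuous_preimage.
by apply/seteqP; split=> v; rewrite -VO /preimage /= (phi'P v).1.
Qed.

End towers.

(** * Path spaces and the extension problem on a cylinder *)

Section path_space.
Variables (R : realType) (N : monoidType).

(** The space of all functions carries the compact-open topology, whose
restriction to continuous paths is the exponential Y^I because I is compact
and regular. *)
Definition paths (Y : topologicalType) : set {compact-open, unit_interval R -> Y} :=
  [set gamma | continuous (gamma : unit_interval R -> Y)].
Arguments paths : clear implicits.

Definition path_space (Y : topologicalType) : Type := paths Y.
HB.instance Definition _ (Y : topologicalType) := Topological.on (path_space Y).

Definition path_at (Y : topologicalType) (gamma : path_space Y) : unit_interval R -> Y :=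
  set_val (gamma : paths Y).

Definition mk_path (Y : topologicalType) (f : unit_interval R -> Y)
  (cf : continuous f) : path_space Y := exist _ f (mem_set (cf : paths Y f)).

Lemma path_at_continuous Y (gamma : path_space Y) : continuous (path_at gamma).
Proof. exact: set_mem (valP (gamma : paths Y)). Qed.

Lemma path_ext Y (gamma delta : path_space Y) :
  path_at gamma =1 path_at delta -> gamma = delta.
Proof. by move=> gd; apply: (@val_inj _ _ (paths Y)); exact/funext. Qed.

Lemma unit_interval_compact : compact [set: unit_interval R].
Proof.
rewrite (_ : [set: _] = @clamp01 R @` `[0, 1]).
  apply: continuous_compact; last exact: segment_compact.
  by apply: continuous_subspaceT; exact: clamp01_continuous.
by apply/seteqP; split=> // t _; exists (val t); [exact: set_mem (valP t)|exact: clamp01K].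
Qed.

Lemma path_eval_continuous (Y : topologicalType) :
  continuous (fun x : path_space Y * unit_interval R => path_at x.1 x.2).
Proof.
rewrite (_ : (fun _ => _) = uncurry (@path_at Y)); last by apply/funext => -[].
apply: (@continuous_uncurry_regular (path_space Y) (unit_interval R) Y (@path_at Y)).
- move=> t _; exists setT; first by rewrite withinET; exact: filterT.
  by split; [exact: unit_interval_compact|exact: closedT].
- exact: (@uniform_regular (`[0 : R, 1]%classic : set R)).
- exact: initial_continuous.
- exact: path_at_continuous.
Qed.

Lemma path_curry_continuous (T Y : topologicalType) (gamma : T -> path_space Y) :
  continuous (fun x : T * unit_interval R => path_at (gamma x.1) x.2) ->
  continuous gamma.
Proof.
move=> cg; apply: (@continuous_comp_initial (paths Y) T
  {compact-open, unit_interval R -> Y} set_val).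
exact: (@continuous_curry_fun T (unit_interval R) Y
  (fun x : T * unit_interval R => path_at (gamma x.1) x.2) cg).
Qed.

Lemma path_endpoint_continuous (Y : topologicalType) (t : unit_interval R) :
  continuous (fun gamma : path_space Y => path_at gamma t).
Proof.
apply: (@continuousT_comp _ _ _ (fun gamma : path_space Y => (gamma, t))
  (fun x => path_at x.1 x.2)); last exact: path_eval_continuous.
by apply: continuous_pairfun; [move=> x; exact: cvg_id|exact: cst_continuous].
Qed.

Section action.
Variable Y : nspaceType N.
Let pact (a : N) (gamma : path_space Y) : path_space Y :=
  mk_path (continuousT_comp (@path_at_continuous Y gamma) (@act_cont N Y a)).
Let pact1 gamma : pact 1%g gamma = gamma.
Proof. by apply: path_ext => t; exact: act1. Qed.
Let pactM a b gamma : pact (a * b)%g gamma = pact a (pact b gamma).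
Proof. by apply: path_ext => t; exact: actM. Qed.
HB.instance Definition _ := isLeftAct.Build N (path_space Y) pact1 pactM.
Let pact_continuous :
  continuous (fun p : discrete_topology N * path_space Y => act (p.1 : N) p.2).
Proof.
apply/(@continuous_discrete_prodP N _ _ (@act N (path_space Y))) => a.
apply: path_curry_continuous.
exact: (continuousT_comp (@path_eval_continuous Y) (@act_cont N Y a)).
Qed.
HB.instance Definition _ := NSet_isContinuousAct.Build N (path_space Y) pact_continuous.

Lemma path_at_act (a : N) (gamma : path_space Y) t :
  path_at (act a gamma) t = act a (path_at gamma t).
Proof. by []. Qed.
End action.

End path_space.

Section paths_in_balls.
Variable R : realType.

Lemma ball_path_related n (x y : unit_ball R n) : path_related R x y.
Proof.
exists (fun t : unit_interval R => ball_proj (val x + val t *: (val y - val x))); split.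
- apply: (@continuousT_comp _ _ _
    (fun t : unit_interval R => val x + val t *: (val y - val x)) (@ball_proj R n));
    last exact: ball_proj_continuous.
  move=> t; apply: (@continuousD _ _ _ (fun=> val x)
    (fun t : unit_interval R => val t *: (val y - val x))).
    exact: cst_continuous.
  apply: (@continuousZ _ _ _ (val : unit_interval R -> R) (fun=> val y - val x)).
    exact: val_interval_continuous.
  exact: cst_continuous.
- by rewrite /= scale0r addr0 ball_projK.
- by rewrite /= scale1r addrC subrK ball_projK.
Qed.

(** The initial segment of the path up to time t, run at constant speed. *)
Lemma path_related_path_at (Y : topologicalType) (gamma : path_space R Y) t :
  path_related R (path_at gamma (I0 R)) (path_at gamma t).
Proof.
exists (fun r => path_at gamma (clamp01 (val r * val t))); split.
- apply: (@continuousT_comp _ _ _ (fun r : unit_interval R => clamp01 (val r * val t)));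
    last exact: path_at_continuous.
  apply: (@continuousT_comp _ _ _ (fun r : unit_interval R => val r * val t) (@clamp01 R));
    last exact: clamp01_continuous.
  move=> r; apply: (@continuousM _ _ (val : unit_interval R -> R) (fun=> val t)).
    exact: val_interval_continuous.
  exact: cst_continuous.
- by rewrite /= mul0r clamp01_le0.
- by rewrite /= mul1r clamp01K.
Qed.

Lemma sphere_ball_proj n (v : 'rV[R]_n.+1) : v != 0 ->
  sphere_ball (sphere_proj v) = ball_proj ((enorm v)^-1 *: v).
Proof.
move=> v0; apply: val_inj; rewrite ball_proj_id; last first.
  by rewrite enormZ ger0_norm ?invr_ge0 ?enorm_ge0 // mulVf ?enorm_eq0.
by rewrite /= (negbTE v0).
Qed.

End paths_in_balls.

(** The data b0, b1 and side form a map on the boundary of the cylinder, whose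
axis is reparametrized as [-1, 1], in the vector space V.  The gauge
max(|v|, |s|) of the cylinder is equal to 1 on the boundary, and shell is the
map on V minus the origin that is constant on rays and agrees with the given
map on the boundary: it is given by mantle on the rays that
meet B^n x [-1, 1] in the sphere and by lid on those that meet an end. *)
Section cylinder.
Variables (R : realType) (Y : topologicalType) (n : nat).
Variables (b0 b1 : unit_ball R n.+1 -> Y) (side : unit_sphere R n.+1 -> path_space R Y).
Hypotheses (cb0 : continuous b0) (cb1 : continuous b1) (cside : continuous side).
Hypothesis side0 : forall v, path_at (side v) (I0 R) = b0 (sphere_ball v).
Hypothesis side1 : forall v, path_at (side v) (I1 R) = b1 (sphere_ball v).
Hypothesis b01 : forall v, path_related R (b0 v) (b1 v).
Hypothesis contr : forall y : Y, contractible R (connected_component [set: Y] y).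

Local Notation V := ('rV[R]_n.+1 * R)%type.

Let radius (x : V) : R := Num.max (enorm x.1) `|x.2|.

Let cnorm1 : continuous (fun x : V => enorm x.1).
Proof.
by move=> x; apply: continuous_comp; [exact: cvg_fst|exact: enorm_continuous].
Qed.

Let cnorm2 : continuous (fun x : V => `|x.2|).
Proof. by move=> x; apply: cvg_norm; exact: cvg_snd. Qed.

Let cradius : continuous radius.
Proof.
by move=> x; apply: (@continuous_max R _ (fun x : V => enorm x.1) (fun x : V => `|x.2|));
  [exact: cnorm1|exact: cnorm2].
Qed.

Let mantle (x : V) : Y :=
  path_at (side (sphere_proj x.1)) (clamp01 ((x.2 / enorm x.1 + 1) / 2)).

Let lid (x : V) : Y :=
  (if 0 < x.2 then b1 else b0) (ball_proj (`|x.2|^-1 *: x.1)).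

Let mantle_continuous x : 0 < enorm x.1 -> {for x, continuous mantle}.
Proof.
move=> x1; apply: (@continuous_comp _ _ _
  (fun x : V => (side (sphere_proj x.1), clamp01 ((x.2 / enorm x.1 + 1) / 2)))
  (fun z : path_space R Y * unit_interval R => path_at z.1 z.2)); last first.
  exact: path_eval_continuous.
apply: continuous_at_pair.
  apply: (@continuous_comp _ _ _ (fun x : V => sphere_proj x.1) side); last exact: cside.
  apply: (@continuous_comp _ _ _ (fst : V -> 'rV[R]_n.+1) (@sphere_proj R n)).
    exact: cvg_fst.
  by apply: sphere_proj_continuous; rewrite -enorm_gt0.
apply: (@continuous_comp _ _ _ (fun x : V => (x.2 / enorm x.1 + 1) / 2) (@clamp01 R));
  last exact: clamp01_continuous.
apply: (@continuousM _ _ (fun x : V => x.2 / enorm x.1 + 1) (fun=> 2^-1)); last exact: cst_continuous.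
apply: (@continuousD R R _ (fun x : V => x.2 / enorm x.1) (fun=> 1)); last exact: cst_continuous.
apply: (@continuousM _ _ (snd : V -> R) (fun x : V => (enorm x.1)^-1)).
  exact: cvg_snd.
by apply: continuousV; [rewrite gt_eqF|exact: cnorm1].
Qed.

Let lid_continuous x : 0 < `|x.2| -> {for x, continuous lid}.
Proof.
move=> x2.
have cl (b : unit_ball R n.+1 -> Y) : continuous b ->
    {for x, continuous (fun x : V => b (ball_proj (`|x.2|^-1 *: x.1)))}.
  move=> cb; apply: (@continuous_comp _ _ _
    (fun x : V => ball_proj (`|x.2|^-1 *: x.1)) b); last exact: cb.
  apply: (@continuous_comp _ _ _ (fun x : V => `|x.2|^-1 *: x.1) (@ball_proj R n.+1));
    last exact: ball_proj_continuous.
  apply: (@continuousZ _ _ _ (fun x : V => `|x.2|^-1) (fst : V -> 'rV[R]_n.+1)).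
    by apply: continuousV; [rewrite gt_eqF|exact: cnorm2].
  exact: cvg_fst.
have csnd : continuous (snd : V -> R) by move=> z; exact: cvg_snd.
move: x2; rewrite normr_gt0 neq_lt => /orP[x2|x2].
  apply: near_eq_continuous_at (cl b0 cb0).
  apply: filterS (near_preimage (csnd x) (@open_lt R 0) x2) => z /= z2.
  by rewrite /lid ltNge ltW.
apply: near_eq_continuous_at (cl b1 cb1).
apply: filterS (near_preimage (csnd x) (@open_gt R 0) x2) => z /= z2.
by rewrite /lid z2.
Qed.

Let mantle_lid x : 0 < enorm x.1 -> `|x.2| = enorm x.1 -> mantle x = lid x.
Proof.
case: x => v s /= v0 sv; rewrite /mantle /lid /= sv -sphere_ball_proj -?enorm_gt0 //.
case: ifPn => s0.
  rewrite -sv gtr0_norm // divff ?gt_eqF // clamp01_ge1 ?side1 //.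
  by rewrite -(natrD R 1 1) divff // pnatr_eq0.
have {}s0 : s < 0.
  rewrite lt_neqAle leNgt s0 andbT; apply/eqP => s1; move: v0.
  by rewrite -sv s1 normr0 ltxx.
rewrite -sv ltr0_norm // invrN mulrN divff ?lt_eqF // addrC subrr mul0r.
by rewrite clamp01_le0 ?side0.
Qed.

Let shell x := if `|x.2| <= enorm x.1 then mantle x else lid x.

Let shell_lid x : 0 < radius x -> enorm x.1 <= `|x.2| -> shell x = lid x.
Proof.
move=> x0 x12; rewrite /shell; case: ifPn => // x21.
have e : `|x.2| = enorm x.1 by apply/le_anti/andP.
by rewrite mantle_lid //; move: x0; rewrite /radius e maxxx.
Qed.

Let shell_continuous x : 0 < radius x -> {for x, continuous shell}.
Proof.
move=> x0.
have cdiff : continuous (fun x : V => enorm x.1 - `|x.2|).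
  move=> z; apply: (@continuousB R R V (fun x : V => enorm x.1) (fun x : V => `|x.2|)).
    exact: cnorm1.
  exact: cnorm2.
have nr := near_preimage (@cradius x) (@open_gt R 0) x0.
have nearA : \forall z \near x, `|z.2| <= enorm z.1 -> shell z = mantle z.
  by apply: filterS nr => z /= _ zz; rewrite /shell zz.
have nearB : \forall z \near x, enorm z.1 <= `|z.2| -> shell z = lid z.
  by apply: filterS nr => z /= z0; exact: shell_lid.
apply: (@closed_cover_continuous_at _ _ [set x : V | `|x.2| <= enorm x.1]
  [set x : V | enorm x.1 <= `|x.2|] mantle lid).
- rewrite (_ : [set x : V | _] = (fun x : V => enorm x.1 - `|x.2|) @^-1` [set r | 0 <= r]).
    by apply: preimage_closed => [z _|]; [exact: cdiff|exact: closed_ge].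
  by apply/seteqP; split=> z /=; rewrite subr_ge0.
- rewrite (_ : [set x : V | _] = (fun x : V => enorm x.1 - `|x.2|) @^-1` [set r | r <= 0]).
    by apply: preimage_closed => [z _|]; [exact: cdiff|exact: closed_le].
  by apply/seteqP; split=> z /=; rewrite subr_le0.
- by move=> z /=; case: (leP `|z.2| (enorm z.1)) => [|/ltW]; [left|right].
- exact: nearA.
- exact: nearB.
- move=> /= x21; apply: mantle_continuous.
  by move: x0; rewrite /radius (max_idPl x21).
- move=> /= x12; apply: lid_continuous.
  by move: x0; rewrite /radius (max_idPr x12).
Qed.

Lemma cylinder_extension : exists h : unit_ball R n.+1 -> path_space R Y,
  [/\ continuous h, forall v, h (sphere_ball v) = side v,
      forall v, path_at (h v) (I0 R) = b0 v
    & forall v, path_at (h v) (I1 R) = b1 v].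
Proof.
pose y0 := b0 (ball_proj 0).
have b0C v : path_related R y0 (b0 v).
  by apply: path_related_map => //; exact: ball_path_related.
have shellC x : 0 < radius x -> path_related R y0 (shell x).
  move=> _; rewrite /shell; case: ifPn => _.
    apply: path_related_trans (path_related_path_at _ _).
    by rewrite side0.
  rewrite /lid; case: ifPn => _; last exact: b0C.
  exact: (path_related_trans (b0C _) (b01 _)).
have [H [cH HE]] := cone_extension (contr y0) cradius shell_continuous shellC.
pose emb (x : unit_ball R n.+1 * unit_interval R) : V := (val x.1, val x.2 * 2 - 1).
have cemb1 : continuous (fun x : unit_ball R n.+1 * unit_interval R => val x.1).
  move=> x; apply: (@continuous_comp _ _ _ fst (val : unit_ball R n.+1 -> 'rV[R]_n.+1)).
    exact: cvg_fst.
  exact: val_ball_continuous.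
have caff : continuous (fun t : unit_interval R => val t * 2 - 1).
  move=> t; apply: (@continuousB R R _ (fun t : unit_interval R => val t * 2) (fun=> 1));
    last exact: cst_continuous.
  apply: (@continuousM _ _ (val : unit_interval R -> R) (fun=> 2));
    last exact: cst_continuous.
  exact: val_interval_continuous.
have cemb2 : continuous (fun x : unit_ball R n.+1 * unit_interval R => val x.2 * 2 - 1).
  move=> x; apply: (@continuous_comp _ _ _ snd (fun t : unit_interval R => val t * 2 - 1)).
    exact: cvg_snd.
  exact: caff.
have cemb : continuous emb by exact: (continuous_pairfun cemb1 cemb2).
have cHe : continuous (H \o emb) by exact: continuousT_comp.
have cHv v : continuous (fun t => H (emb (v, t))).
  apply: (@continuousT_comp _ _ _ (fun t => (v, t)) (H \o emb)) cHe.
  by apply: continuous_pairfun; [exact: cst_continuous|move=> x; exact: cvg_id].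
exists (fun v => mk_path (cHv v)); split.
- apply: path_curry_continuous.
  have E : H \o emb = fun x => path_at (mk_path (cHv x.1)) x.2.
    by apply/funext => -[].
  by rewrite E in cHe.
- move=> v; apply: path_ext => t.
  have /andP[t0 t1] : 0 <= val t <= 1 by have := set_mem (valP t); rewrite /= in_itv.
  have tn : `|val t * 2 - 1| <= 1 by rewrite ler_norml; apply/andP; split; lra.
  rewrite /path_at /mk_path set_valE /= HE /emb /radius /=; last first.
    by rewrite enorm_sphere le_max lexx.
  rewrite /shell /= enorm_sphere tn /mantle /= sphere_projK enorm_sphere divr1 subrK.
  by rewrite mulfK ?pnatr_eq0 // clamp01K.
- move=> v; rewrite /path_at /mk_path set_valE /=.
  have r1 : radius (emb (v, I0 R)) = 1.
    by rewrite /radius /emb /= mul0r sub0r normrN1 (max_idPr (enorm_ball v)).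
  rewrite HE ?r1 // shell_lid ?r1 //; last first.
    by rewrite /emb /= mul0r sub0r normrN1 enorm_ball.
  rewrite /lid /emb /= mul0r sub0r normrN1 invr1 scale1r ball_projK.
  by rewrite ltNge lerN10.
- move=> v; rewrite /path_at /mk_path set_valE /=.
  have e1 : 1 * 2 - 1 = 1 :> R by lra.
  have r1 : radius (emb (v, I1 R)) = 1.
    by rewrite /radius /emb /= e1 normr1 (max_idPr (enorm_ball v)).
  rewrite HE ?r1 // shell_lid ?r1 //; last first.
    by rewrite /emb /= e1 normr1 enorm_ball.
  by rewrite /lid /emb /= e1 normr1 invr1 scale1r ball_projK ltr01.
Qed.

End cylinder.

(** * Maps between complexes *)

Section cw_facts.
Variables (R : realType) (N : monoidType) (X : projective_cw R N).

Lemma cw_cell_continuous n (q : cw_cells X n.+1) :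
  continuous (fun v : unit_ball R n.+1 => cw_incl (cw_char (q, v)) : X).
Proof.
apply: (@continuousT_comp (unit_ball R n.+1) (discrete_nspace N (cw_cells X n.+1) *
  trivial_nspace N (unit_ball R n.+1))%type X (fun v => (q, v)) (fun x => cw_incl (cw_char x))).
  by apply: continuous_pairfun; [exact: cst_continuous | move=> x; exact: cvg_id].
exact: (continuousT_comp (cw_char_nmap X n).1 (cw_incl_nmap X n.+1).1).
Qed.

(** A point of a cell is joined to a point of the boundary sphere inside the
cell, and one goes down the skeleta.  This is the case m = 0 of cellular
approximation, where the path is needed and not only its end. *)
Lemma cw_path_to_vertex (x : X) : exists z : cw_skel X 0, path_related R (cw_incl z) x.
Proof.
have [n [s <-]] := colimit_surj (@cw_colimit R N X) x; elim: n s {x} => [|n IH] s.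
  by exists s; exact: path_related_refl.
have [[b <-]|[[q v] <-]] := pushout_surj (@cw_pushout R N X n) s.
  by rewrite cw_incl_step; exact: IH.
have [z zb] := IH (cw_attach (q, sphere_proj 0)).
exists z; apply: path_related_trans zb _; rewrite -cw_incl_step cw_step_attach.
exact: (path_related_map (@cw_cell_continuous n q) (ball_path_related _ _)).
Qed.

Lemma cw_cell_step m n : (m <= n)%N -> cell_step R m (@cw_step R N X n).
Proof.
move=> mn; exists n, (cw_cells X n.+1), (@cw_attach R N X n), (@cw_char R N X n).
by split=> //; exact: cw_pushout.
Qed.

End cw_facts.

Section maps_of_cw.
Variables (R : realType) (N : monoidType) (X : projective_cw R N).

(** The lifting problem is posed for the constant tower Y^I over Y x Y. *)
Lemma pi0_homotopy (Y : nspaceType N) (f g : X -> Y) :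
  (forall y : Y, contractible R (connected_component [set: Y] y)) ->
  nmap f -> nmap g -> (forall x, path_related R (f x) (g x)) -> nhomotopic R f g.
Proof.
move=> contr nf ng fg.
pose E (n : nat) : nspaceType N := path_space R Y.
pose ends (n : nat) (gamma : E n) : (Y * Y)%type :=
  (path_at gamma (I0 R), path_at gamma (I1 R)).
pose b (x : X) : (Y * Y)%type := (f x, g x).
have nends n : nmap (ends n).
  split=> [|a gamma]; last by rewrite /ends !path_at_act.
  by apply: continuous_pairfun; exact: path_endpoint_continuous.
have nb : nmap b.
  split=> [|a x]; last by rewrite /b nf.2 ng.2.
  exact: (continuous_pairfun nf.1 ng.1).
have [||F [nF Fs eF]] := @cw_lifting R N X E (fun _ => id) (Y * Y)%type ends b
  (fun _ => nmap_id _) nends (fun _ => erefl) nb.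
- move=> p; have [gamma [cg g0 g1]] := fg (cw_incl (cw_vertices p)).
  by exists (mk_path cg); rewrite /ends /b -g0 -g1.
- move=> n q side cside sideE.
  have cchar := @cw_cell_continuous R N X n q.
  have [||h [ch hs h0 h1]] := @cylinder_extension R Y n _ _ side
    (continuousT_comp cchar nf.1) (continuousT_comp cchar ng.1) cside
    (fun v => congr1 fst (sideE v)) (fun v => congr1 snd (sideE v)).
  + by move=> v; exact: fg.
  + exact: contr.
  by exists h; split=> // v; rewrite /ends h0 h1.
have [_ univ] := @cw_colimit R N X.
have [u [[nu uF] _]] := univ (path_space R Y) F nF Fs.
have uE x : ends 0%N (u x) = b x.
  have [n [s <-]] := colimit_surj (@cw_colimit R N X) x.
  rewrite -[RHS](congr1 (@^~ s) (eF n) : ends n (F n s) = _).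
  by congr ends; exact: (congr1 (@^~ s) (uF n)).
exists (fun x => path_at (u x.1) x.2); split.
- split; last by move=> a [x t]; rewrite /= nu.2.
  have c1 : continuous (fun x : X * unit_interval R => u x.1).
    by move=> x; apply: continuous_comp; [exact: cvg_fst|exact: nu.1].
  have c2 : continuous (fun x : X * unit_interval R => x.2).
    by move=> x; exact: cvg_snd.
  exact: (continuousT_comp (continuous_pairfun c1 c2) (@path_eval_continuous R Y)).
- by move=> x; exact: (congr1 fst (uE x)).
- by move=> x; exact: (congr1 snd (uE x)).
Qed.

(** The target of the lifting problem is pi0 Y with the indiscrete topology,
so that lifting along Y_n -> pi0 Y amounts to prescribing the path component
of each value. *)
Lemma cellular_realization (Y : projective_cw R N) (theta : pi0 R X -> pi0 R Y) :
  (forall y : Y, contractible R (connected_component [set: Y] y)) ->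
  equivariant theta ->
  exists f : X -> Y, [/\ nmap f, cellular f
    & forall x, pi0_class R (f x) = theta (pi0_class R x)].
Proof.
move=> contr etheta.
pose cls n (y : cw_skel Y n) : indiscrete (pi0 R Y) := pi0_class R (cw_incl y : Y).
pose b (x : X) : indiscrete (pi0 R Y) := theta (pi0_class R x).
have ncls n : nmap (@cls n).
  split=> [|a y]; first exact: indiscrete_continuous.
  by rewrite /cls (cw_incl_nmap Y n).2 -act_pi0E.
have nb : nmap b.
  split=> [|a x]; first exact: indiscrete_continuous.
  by rewrite /b -act_pi0E etheta.
have cls_step n : @cls n.+1 \o @cw_step R N Y n = @cls n.
  by apply/funext => y; rewrite /cls /= cw_incl_step.
have [||F [nF Fs eF]] := @cw_lifting R N X (cw_skel Y) (@cw_step R N Y)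
  (indiscrete (pi0 R Y)) cls b (@cw_step_nmap R N Y) ncls cls_step nb.
- move=> p; rewrite /b; set c := theta _.
  have [y <-] : exists y : Y, pi0_class R y = c by eexists; exact: pi0_classK.
  have [z zy] := cw_path_to_vertex y.
  by exists z; exact/pi0_eqP.
- move=> n q g cg gE.
  (* Any two points of the cell are in the same path component of X, hence
     the values of g are in the same path component of Y. *)
  pose y0 : Y := cw_incl (g (sphere_proj 0)).
  have bE v w : b (cw_incl (cw_char (q, v))) = b (cw_incl (cw_char (q, w))).
    rewrite /b; congr theta; apply/pi0_eqP.
    exact: (path_related_map (@cw_cell_continuous R N X n q) (ball_path_related v w)).
  pose sph (v : 'rV[R]_n.+1) : Y := cw_incl (g (sphere_proj v)).
  have csph v : 0 < enorm v -> {for v, continuous sph}.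
    rewrite enorm_gt0 => v0.
    apply: (@continuous_comp _ _ _ (@sphere_proj R n) (@cw_incl R N Y n \o g)).
      exact: sphere_proj_continuous.
    exact: (continuousT_comp cg (cw_incl_nmap Y n).1).
  have sphC v : 0 < enorm v -> path_related R y0 (sph v).
    move=> _; apply/pi0_eqP.
    exact: (etrans (gE _) (etrans (bE _ _) (esym (gE (sphere_proj v))))).
  have [H [cH HE]] := cone_extension (contr y0) (@enorm_continuous R n.+1) csph sphC.
  have [|psi [cpsi psig]] := @cellular_extension R N n.+1 n.+1 (cw_skel Y)
    (@cw_step R N Y) Y (@cw_incl R N Y) (@cw_step R N Y n \o g) (H \o val)
    (@cw_colimit R N Y) (fun k => @cw_cell_step R N Y 0 k (leq0n k))
    (fun k nk => @cw_cell_step R N Y n.+1 k nk)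
    (continuousT_comp (@val_ball_continuous R n.+1) cH).
    move=> s; rewrite /comp cw_incl_step HE /sph /=; last by rewrite enorm_sphere.
    by rewrite sphere_projK.
  exists psi; split=> // v.
  rewrite (bE v (sphere_ball (sphere_proj 0))) -gE.
  transitivity (@cls n.+1 (psi (sphere_ball (sphere_proj 0)))).
    apply/pi0_eqP.
    exact: (path_related_map (continuousT_comp cpsi (cw_incl_nmap Y n.+1).1)
      (ball_path_related _ _)).
  by rewrite psig; exact: (congr1 (@^~ (g (sphere_proj 0))) (cls_step n)).
have [_ univ] := @cw_colimit R N X.
have [||u [[nu uF] _]] := univ Y (fun n => @cw_incl R N Y n \o F n).
- by move=> n; apply: nmap_comp; [exact: nF|exact: cw_incl_nmap].
- move=> n; apply/funext => x; rewrite /comp -[RHS]cw_incl_step; congr cw_incl.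
  exact: (congr1 (@^~ x) (Fs n)).
have uE n s : u (cw_incl s) = cw_incl (F n s) by exact: (congr1 (@^~ s) (uF n)).
exists u; split=> //.
- by move=> n _ [_ [s _ <-] <-]; rewrite uE; exists (F n s).
- move=> x; have [n [s <-]] := colimit_surj (@cw_colimit R N X) x.
  by rewrite uE; exact: (congr1 (@^~ s) (eF n)).
Qed.

End maps_of_cw.

Lemma pi0_homotopy_equivalence (R : realType) (N : monoidType)
    (X Y : projective_cw R N) :
  nset_isomorphic (pi0 R X) (pi0 R Y) ->
  (forall x : X, contractible R (connected_component [set: X] x)) ->
  (forall y : Y, contractible R (connected_component [set: Y] y)) ->
  exists f : X -> Y, cellular f /\ nhomotopy_equivalence R f.
Proof.
move=> [theta [etheta [zeta thetaK zetaK]]] contrX contrY.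
have ezeta : equivariant zeta.
  by move=> a c; rewrite -{1}[c]zetaK -etheta thetaK.
have [f [nf cf fE]] := cellular_realization contrY etheta.
have [g [ng _ gE]] := cellular_realization contrX ezeta.
exists f; split=> //; split=> //; exists g; split=> //.
- apply: pi0_homotopy => //; [exact: nmap_comp|exact: nmap_id|].
  by move=> x; apply/pi0_eqP; rewrite /= gE fE thetaK.
- apply: pi0_homotopy => //; [exact: nmap_comp|exact: nmap_id|].
  by move=> y; apply/pi0_eqP; rewrite /= fE gE zetaK.
Qed.

Lemma nset_isomorphic_span (N : monoidType) (A B C : nsetType N) :
  nset_isomorphic A C -> nset_isomorphic B C -> nset_isomorphic A B.
Proof.
move=> [f [ef bf]] [g [eg [h gK hK]]].
have eh : equivariant h by move=> a c; rewrite -{1}[c]hK -eg gK.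
exists (h \o f); split; first by move=> a x; rewrite /= ef eh.
by apply: bij_comp bf; exists g.
Qed.

Theorem theorem7p2 (R : realType) (M : monoidType)
    (X Y : projective_cw R (M * opp_monoid M)%type)
    (hX : biequivariant_classifying_space X)
    (hY : biequivariant_classifying_space Y) :
  exists f : X -> Y, cellular f /\ nhomotopy_equivalence R f.
Proof.
have [isoX contrX] := hX; have [isoY contrY] := hY.
by apply: pi0_homotopy_equivalence => //; exact: nset_isomorphic_span isoX isoY.
Qed.
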